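(* Let $R$ be a commutative unital ring. Let $G$ be an algebraic $R$-group and let $V$ be a $G$-module which is finitely generated and projective as an $R$-module. Then there is a prime $p_V$ such that whenever $k$ is an $R$-field of characteristic $p\geq p_V$, the centraliser $C_{G_k}(W)$ and the normaliser $N_{G_k}(W)$ are smooth for any $k$-subspace $W$ of $V_k$.
   Context: An algebraic $R$-group is a finitely presented affine $R$-group scheme, i.e. its coordinate ring $R[G]$ is a finitely presented $R$-algebra (it is not assumed smooth). An $R$-field is an $R$-algebra which is also a field. A $G$-module is an $R$-module $V$ with an action of $G$ on the functor $Q\mapsto V\otimes_R Q$ such that $G(Q)$ acts by $Q$-linear maps for every $R$-algebra $Q$. When $V$ is finitely generated projective it is regarded as an affine $G$-scheme with coordinate ring the symmetric algebra $S(V^* )$. $G_k$ and $V_k=V\otimes_R k$ denote base changes, and a subspace $W$ of $V_k$ is regarded as a closed subscheme of $V_k$. For a field $k$, a $k$-group scheme $H$ acting on a $k$-scheme $Z$ via $\alpha$, and a closed subscheme $Y\subseteq Z$, define $k$-subgroup functors of $H$ as follows, for every $k$-algebra $Q$. The centraliser $C_H(Y)(Q)$ is the set of $g\in H(Q)$ with $\alpha(g,h)=h$ for all $h\in Y(Q')$ and all $Q$-algebras $Q'$. The normaliser $N_H(Y)(Q)$ is the set of $g\in H(Q)$ such that $\alpha(g,h)\in Y(Q')$ and $\alpha(g^{-1},h)\in Y(Q')$ for all $h\in Y(Q')$ and all $Q$-algebras $Q'$. *)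

(* Defs.v *)
(* Affine group schemes over R and their modules are treated through their
   functors of points on the category of commutative R-algebras. *)
From HB Require Import structures.
From mathcomp Require Import all_boot all_order all_algebra.
From mathcomp Require Import boolp.
From mathcomp Require Import mpoly.

Set Implicit Arguments.
Unset Strict Implicit.
Unset Printing Implicit Defensive.

Import GRing.Theory.
Local Open Scope ring_scope.
Local Open Scope quotient_scope.

(* The structure map is kept as data, rather than using comAlgType, so that
   restriction of scalars is composition; "Pz" rings include the zero ring. *)
Record algebra (R : comPzRingType) := Algebra {
  algebra_ring :> comPzRingType;
  structure_map : {rmorphism R -> algebra_ring} }.

Record algebra_hom (R : comPzRingType) (A B : algebra R) := AlgebraHom {
  hom_fun :> {rmorphism A -> B};
  hom_structure : forall r, hom_fun (structure_map A r) = structure_map B r }.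

Lemma algebra_hom_ext (R : comPzRingType) (A B : algebra R)
  (f g : algebra_hom A B) : f =1 g -> f = g.
Proof.
move=> fg; have {}fg : (f : A -> B) = g by apply/funext.
case: f g fg => [[f cf] fs] [[g cg] gs] /= fg; move: cg gs; rewrite -{}fg.
case: cf fs => [[f0] [f1]] fs [[g0] [g1]] gs.
move: fs gs; rewrite (Prop_irrelevance g0 f0) (Prop_irrelevance g1 f1) => fs gs.
by rewrite (Prop_irrelevance gs fs).
Qed.

Section AlgebraHoms.
Variable R : comPzRingType.

Definition hom_id (A : algebra R) : algebra_hom A A :=
  @AlgebraHom R A A idfun (fun=> erefl).

Lemma hom_comp_structure (A B C : algebra R) (g : algebra_hom B C)
  (f : algebra_hom A B) r :
  (g \o f) (structure_map A r) = structure_map C r.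
Proof. by rewrite /= !hom_structure. Qed.

Definition hom_comp (A B C : algebra R) (g : algebra_hom B C)
    (f : algebra_hom A B) : algebra_hom A C :=
  AlgebraHom (hom_comp_structure g f).

End AlgebraHoms.

Definition mpoly_algebra (R : comNzRingType) (n : nat) : algebra R :=
  Algebra (mpolyC n (R := R)).

Definition finitely_presented (R : comNzRingType) (A : algebra R) : Prop :=
  exists (n : nat) (f : algebra_hom (mpoly_algebra R n) A),
    (forall a, exists p, f p = a) /\
    exists (m : nat) (s : 'I_m -> {mpoly R[n]}), forall p,
      f p = 0 <-> exists c : 'I_m -> {mpoly R[n]}, p = \sum_i c i * s i.

(* Surjections of algebras with square-zero kernel are the maps B -> B / I
   with I ^ 2 = 0, up to isomorphism. *)
Definition formally_smooth (R : comPzRingType) (A : algebra R) : Prop :=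
  forall (B C : algebra R) (q : algebra_hom B C),
    (forall c, exists b, q b = c) ->
    (forall x y, q x = 0 -> q y = 0 -> x * y = 0) ->
  forall f : algebra_hom A C, exists g : algebra_hom A B, hom_comp q g = f.

Definition smooth_algebra (R : comNzRingType) (A : algebra R) : Prop :=
  finitely_presented A /\ formally_smooth A.

Record set_functor (R : comPzRingType) := SetFunctor {
  points :> algebra R -> Type;
  fmap : forall Q Q', algebra_hom Q Q' -> points Q -> points Q';
  fmap_id : forall Q x, fmap (hom_id Q) x = x;
  fmap_comp : forall Q Q' Q'' (g : algebra_hom Q' Q'') (f : algebra_hom Q Q') x,
    fmap (hom_comp g f) x = fmap g (fmap f x) }.

Record group_functor (R : comPzRingType) := GroupFunctor {
  group_points :> algebra R -> groupType;
  gmap : forall Q Q', algebra_hom Q Q' -> group_points Q -> group_points Q';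
  gmapM : forall Q Q' (f : algebra_hom Q Q') x y,
    gmap f (x * y)%g = (gmap f x * gmap f y)%g;
  gmap_id : forall Q x, gmap (hom_id Q) x = x;
  gmap_comp : forall Q Q' Q'' (g : algebra_hom Q' Q'') (f : algebra_hom Q Q') x,
    gmap (hom_comp g f) x = gmap g (gmap f x) }.

(* Q |-> S Q is, naturally in Q, in bijection with Q |-> Hom_R(A, Q): the
   subfunctor S is an affine scheme with coordinate ring A. *)
Definition represented_by (R : comPzRingType) (G : group_functor R)
    (S : forall Q, G Q -> Prop) (A : algebra R) : Prop :=
  exists ev : forall Q, algebra_hom A Q -> G Q,
    [/\ forall Q Q' (f : algebra_hom Q Q') h,
          gmap f (ev Q h) = ev Q' (hom_comp f h),
        forall Q, injective (ev Q) &
        forall Q x, S Q x <-> exists h, ev Q h = x].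

Definition algebraic_group (R : comNzRingType) (G : group_functor R) : Prop :=
  exists A : algebra R,
    finitely_presented A /\ represented_by (G := G) (fun _ _ => True) A.

Definition smooth_subgroup (R : comNzRingType) (G : group_functor R)
    (S : forall Q, G Q -> Prop) : Prop :=
  exists A : algebra R, smooth_algebra A /\ represented_by S A.

Record action (R : comPzRingType) (H : group_functor R) (Z : set_functor R) :=
  Action {
    act : forall Q, H Q -> Z Q -> Z Q;
    act1 : forall Q x, act (1%g : H Q) x = x;
    actM : forall Q (g h : H Q) x, act (g * h)%g x = act g (act h x);
    act_natural : forall Q Q' (f : algebra_hom Q Q') (g : H Q) x,
      fmap f (act g x) = act (gmap f g) (fmap f x) }.

Section Subgroups.
Variables (R : comPzRingType) (H : group_functor R) (Z : set_functor R).
Variables (alpha : action H Z) (Y : forall Q, Z Q -> Prop).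

Definition centraliser (Q : algebra R) (g : H Q) : Prop :=
  forall Q' (f : algebra_hom Q Q') (h : Z Q'),
    Y h -> act alpha (gmap f g) h = h.

Definition normaliser (Q : algebra R) (g : H Q) : Prop :=
  forall Q' (f : algebra_hom Q Q') (h : Z Q'),
    Y h -> Y (act alpha (gmap f g) h) /\ Y (act alpha (gmap f g^-1%g) h).

End Subgroups.

Section BaseChange.
Variables (R k : comPzRingType) (phi : {rmorphism R -> k}).

Definition restrict (Q : algebra k) : algebra R :=
  Algebra (structure_map Q \o phi).

Definition restrict_hom (Q Q' : algebra k) (f : algebra_hom Q Q') :
    algebra_hom (restrict Q) (restrict Q') :=
  @AlgebraHom R (restrict Q) (restrict Q') f (fun r => hom_structure f (phi r)).

Definition structure_hom (Q : algebra k) :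
    algebra_hom (Algebra phi) (restrict Q) :=
  @AlgebraHom R (Algebra phi) (restrict Q) (structure_map Q) (fun=> erefl).

Definition base_change (Z : set_functor R) : set_functor k.
Proof.
apply: (@SetFunctor k (fun Q => Z (restrict Q))
  (fun Q Q' f => fmap (restrict_hom f))) => [Q x|Q Q' Q'' g f x].
  by rewrite -[RHS]fmap_id; congr fmap; apply: algebra_hom_ext.
by rewrite -fmap_comp; congr fmap; apply: algebra_hom_ext.
Defined.

Definition base_change_group (G : group_functor R) : group_functor k.
Proof.
apply: (@GroupFunctor k (fun Q => G (restrict Q))
  (fun Q Q' f => gmap (restrict_hom f))) => [Q Q' f x y|Q x|Q Q' Q'' g f x].
- exact: gmapM.
- by rewrite -[RHS]gmap_id; congr gmap; apply: algebra_hom_ext.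
- by rewrite -gmap_comp; congr gmap; apply: algebra_hom_ext.
Defined.

Definition base_change_action (G : group_functor R) (Z : set_functor R)
    (alpha : action G Z) :
    action (base_change_group G) (base_change Z) :=
  @Action k (base_change_group G) (base_change Z)
    (fun Q => act alpha (Q := restrict Q))
    (fun Q => act1 alpha (Q := restrict Q))
    (fun Q => actM alpha (Q := restrict Q))
    (fun Q Q' f => act_natural alpha (restrict_hom f)).

End BaseChange.

Section Tensor.
Variables (R : comPzRingType) (V : lmodType R) (Q : algebra R).

Record balanced (M : zmodType) (b : V -> Q -> M) : Prop := Balanced {
  balancedDl : forall v w q, b (v + w) q = b v q + b w q;
  balancedDr : forall v q q', b v (q + q') = b v q + b v q';
  balancedZ : forall r v q, b (r *: v) q = b v (structure_map Q r * q) }.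

Definition tensor_eval (M : zmodType) (b : V -> Q -> M) (s : seq (V * Q)) : M :=
  \sum_(x <- s) b x.1 x.2.

(* A list of pairs stands for the sum of the pure tensors v (x) q; two such
   sums are equal when no balanced map separates them. *)
Definition tensor_rel : rel (seq (V * Q)) := fun s t =>
  `[< forall (M : zmodType) (b : V -> Q -> M),
        balanced b -> tensor_eval b s = tensor_eval b t >].

Lemma tensor_rel_equiv : equiv_class_of tensor_rel.
Proof.
split=> [s|s t|t s u].
- exact/asboolP.
- by apply/asboolP/asboolP => st M b /st.
- by move=> /asboolP st /asboolP tu; apply/asboolP => M b bb; rewrite st ?tu.
Qed.

Canonical tensor_rel_canonical := EquivRelPack tensor_rel_equiv.

Definition tensor := {eq_quot tensor_rel}.

HB.instance Definition _ := Choice.on tensor.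

Definition tensor_sum (s : seq (V * Q)) : tensor := \pi s.

Definition pure_tensor (v : V) (q : Q) : tensor := tensor_sum [:: (v, q)].

Definition tensor_lift (M : zmodType) (b : V -> Q -> M) (x : tensor) : M :=
  tensor_eval b (repr x).

Lemma tensor_lift_sum (M : zmodType) (b : V -> Q -> M) s :
  balanced b -> tensor_lift b (tensor_sum s) = tensor_eval b s.
Proof.
move=> bb; have /eqmodP/asboolP := reprK (tensor_sum s).
exact.
Qed.

Lemma tensor_ext (x y : tensor) :
  (forall (M : zmodType) (b : V -> Q -> M),
     balanced b -> tensor_lift b x = tensor_lift b y) -> x = y.
Proof.
by move=> xy; rewrite -[x]reprK -[y]reprK; apply/eqmodP/asboolP.
Qed.

Definition tensor_zero : tensor := tensor_sum [::].
Definition tensor_add (x y : tensor) : tensor := tensor_sum (repr x ++ repr y).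
Definition tensor_opp (x : tensor) : tensor :=
  tensor_sum [seq (u.1, - u.2) | u <- repr x].
Definition tensor_scale (a : Q) (x : tensor) : tensor :=
  tensor_sum [seq (u.1, a * u.2) | u <- repr x].

Lemma balanced_scale a (M : zmodType) (b : V -> Q -> M) :
  balanced b -> balanced (fun v q => b v (a * q)).
Proof.
case=> bDl bDr bZ; split=> // *; first by rewrite mulrDr bDr.
by rewrite bZ mulrCA.
Qed.

Lemma balancedNr (M : zmodType) (b : V -> Q -> M) v q :
  balanced b -> b v (- q) = - b v q.
Proof.
move=> bb; have b0 : b v 0 = 0.
  by apply: (addIr (b v 0)); rewrite -(balancedDr bb) !add0r.
by apply: (addIr (b v q)); rewrite -(balancedDr bb) !addNr.
Qed.

Section Lift.
Variables (M : zmodType) (b : V -> Q -> M).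
Hypothesis bb : balanced b.

Lemma tensor_lift0 : tensor_lift b tensor_zero = 0.
Proof. by rewrite tensor_lift_sum // /tensor_eval big_nil. Qed.

Lemma tensor_liftD x y :
  tensor_lift b (tensor_add x y) = tensor_lift b x + tensor_lift b y.
Proof. by rewrite tensor_lift_sum // /tensor_eval big_cat. Qed.

Lemma tensor_liftN x : tensor_lift b (tensor_opp x) = - tensor_lift b x.
Proof.
rewrite tensor_lift_sum // /tensor_eval big_map /= -sumrN.
by apply: eq_bigr => u _; rewrite balancedNr.
Qed.

Lemma tensor_liftZ a x :
  tensor_lift b (tensor_scale a x) = tensor_lift (fun v q => b v (a * q)) x.
Proof. by rewrite tensor_lift_sum // /tensor_eval big_map. Qed.

End Lift.

Lemma tensor_addA : associative tensor_add.
Proof.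
by move=> x y z; apply: tensor_ext => M b bb; rewrite !tensor_liftD // addrA.
Qed.

Lemma tensor_addC : commutative tensor_add.
Proof.
by move=> x y; apply: tensor_ext => M b bb; rewrite !tensor_liftD // addrC.
Qed.

Lemma tensor_add0 : left_id tensor_zero tensor_add.
Proof.
move=> x; apply: tensor_ext => M b bb.
by rewrite tensor_liftD // tensor_lift0 // add0r.
Qed.

Lemma tensor_addN : left_inverse tensor_zero tensor_opp tensor_add.
Proof.
move=> x; apply: tensor_ext => M b bb.
by rewrite tensor_liftD // tensor_liftN // tensor_lift0 // addNr.
Qed.

HB.instance Definition _ := GRing.isZmodule.Build tensor
  tensor_addA tensor_addC tensor_add0 tensor_addN.

Lemma tensor_scaleA a c x :
  tensor_scale a (tensor_scale c x) = tensor_scale (a * c) x.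
Proof.
apply: tensor_ext => M b bb.
rewrite !tensor_liftZ //; last exact: balanced_scale.
by congr tensor_lift; apply/funext => v; apply/funext => q; rewrite mulrA.
Qed.

Lemma tensor_scale1 : left_id 1 tensor_scale.
Proof.
move=> x; apply: tensor_ext => M b bb; rewrite tensor_liftZ //.
by congr tensor_lift; apply/funext => v; apply/funext => q; rewrite mul1r.
Qed.

Lemma tensor_scaleDr : right_distributive tensor_scale +%R.
Proof.
move=> a x y; apply: tensor_ext => M b bb.
rewrite tensor_liftZ // !tensor_liftD //; first by rewrite !tensor_liftZ.
exact: balanced_scale.
Qed.

Lemma tensor_scaleDl x :
  {morph tensor_scale^~ x : a c / (a + c)%R >-> (a + c)%R}.
Proof.
move=> a c; apply: tensor_ext => M b bb.
rewrite tensor_liftD // !tensor_liftZ // /tensor_lift /tensor_eval -big_split /=.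
by apply: eq_bigr => u _; rewrite mulrDl (balancedDr bb).
Qed.

HB.instance Definition _ := GRing.Zmodule_isLmodule.Build Q tensor
  tensor_scaleA tensor_scale1 tensor_scaleDr tensor_scaleDl.

Lemma pure_tensor_balanced : balanced pure_tensor.
Proof.
split=> *; apply: tensor_ext => M b bb;
  rewrite ?tensor_liftD // !tensor_lift_sum // /tensor_eval !big_seq1 /=;
  by case: bb.
Qed.

Lemma tensor_lift_pure (M : zmodType) (b : V -> Q -> M) v q :
  balanced b -> tensor_lift b (pure_tensor v q) = b v q.
Proof. by move=> bb; rewrite tensor_lift_sum // /tensor_eval big_seq1. Qed.

Lemma tensor_sumE s : tensor_sum s = \sum_(u <- s) pure_tensor u.1 u.2.
Proof.
elim: s => [|u s IHs]; first by rewrite big_nil.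
rewrite big_cons -IHs; apply: tensor_ext => M b bb.
by rewrite tensor_liftD // !tensor_lift_sum // /tensor_eval big_cons big_seq1.
Qed.

End Tensor.

Section TensorFunctor.
Variables (R : comPzRingType) (V : lmodType R).

Definition tensor_map (Q Q' : algebra R) (f : algebra_hom Q Q')
    (x : tensor V Q) : tensor V Q' :=
  tensor_sum [seq (u.1, f u.2) | u <- repr x].

Lemma balanced_map (Q Q' : algebra R) (f : algebra_hom Q Q') (M : zmodType)
  (b : V -> Q' -> M) : balanced b -> balanced (fun v q => b v (f q)).
Proof.
case=> bDl bDr bZ; split=> // *; first by rewrite rmorphD bDr.
by rewrite bZ rmorphM hom_structure.
Qed.

Lemma tensor_lift_map (Q Q' : algebra R) (f : algebra_hom Q Q') (M : zmodType)
    (b : V -> Q' -> M) x : balanced b ->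
  tensor_lift b (tensor_map f x) = tensor_lift (fun v q => b v (f q)) x.
Proof. by move=> bb; rewrite tensor_lift_sum // /tensor_eval big_map. Qed.

Definition tensor_functor : set_functor R.
Proof.
apply: (@SetFunctor R (tensor V) tensor_map) => [Q x|Q Q' Q'' g f x].
  by apply: tensor_ext => M b bb; rewrite tensor_lift_map.
apply: tensor_ext => M b bb; rewrite !tensor_lift_map //.
exact: balanced_map.
Defined.

End TensorFunctor.

Record group_module (R : comPzRingType) (G : group_functor R)
    (V : lmodType R) := GroupModule {
  module_action :> action G (tensor_functor V);
  module_linear : forall Q (g : G Q),
    linear (act module_action g : tensor V Q -> tensor V Q) }.

Definition finitely_generated (R : comPzRingType) (V : lmodType R) : Prop :=
  exists (n : nat) (e : 'I_n -> V),
    forall v, exists c : 'I_n -> R, v = \sum_i c i *: e i.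

Definition projective (R : comPzRingType) (V : lmodType R) : Prop :=
  forall (M N : lmodType R) (g : {linear M -> N}) (f : {linear V -> N}),
    (forall n, exists m, g m = n) ->
    exists h : {linear V -> M}, forall v, g (h v) = f v.

(* The closed subscheme of V_k defined by a subspace W: its Q-points are the
   image of W (x)_k Q in V_k (x)_k Q = V (x)_R Q. *)
Definition subspace_points (R k : comPzRingType) (phi : {rmorphism R -> k})
    (V : lmodType R) (W : {pred tensor V (Algebra phi)}) :
    forall Q, base_change phi (tensor_functor V) Q -> Prop := fun Q x =>
  exists (n : nat) (c : 'I_n -> restrict phi Q)
    (w : 'I_n -> tensor V (Algebra phi)),
    (forall i, w i \in W) /\
    x = \sum_i c i *: tensor_map (structure_hom phi Q) (w i).

(* Main.v *)
(* A finitely presented algebra k[x]/(f) is formally smooth as soon as its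
   conormal sequence splits, and a splitting is a finite family of polynomials
   satisfying identities over k.  The equations of the centraliser and of the
   normaliser of W are polynomials over R and the entries of a projector onto W.
   So if smoothness failed in arbitrarily large characteristic, an ultraproduct
   of the bad fields would be a field K of characteristic 0, with a subspace of
   V_K whose centraliser (or normaliser) has no splitting: an identity over K
   would hold over some of the bad fields.  This contradicts Cartier's theorem
   over K.

   Cartier's theorem itself is proved as follows.  Let I be the ideal of a closed
   subgroup of affine space.  Translations make its module of differentials
   projective, which gives a vector field Y with coefficients in I such that f - Yf
   and its first derivatives lie in I for every f in I.  In characteristic 0, up to
   I^2, such elements have all their derivatives up to any order N in I, hence
   vanish to order N along the diagonal of two copies of the group; by Krull's
   intersection theorem they lie in I^2, so that Y splits the conormal sequence. *)
Require Import Defs.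
From HB Require Import structures.
From mathcomp Require Import all_boot all_order all_algebra.
From mathcomp Require Import boolp ssrcomplements mpoly ring.
From mathcomp Require classical_sets.

Set Implicit Arguments.
Unset Strict Implicit.
Unset Printing Implicit Defensive.

Import GRing.Theory.
Local Open Scope ring_scope.
Local Open Scope quotient_scope.

(** * Ideals, quotients and evaluation *)

(** The field, the subspace and its dimension all vary, so they are put in one shape: V is a summand
    of a free module of rank N, and W becomes an N by N idempotent matrix, whatever its dimension.
    The number of equations is then fixed, and they make sense over every nonzero commutative ring,
    in particular over the product of the bad fields, which mediates between these fields and their
    ultraproduct. Degrees take care of themselves: a splitting over K has finitely many
    coefficients, lifts to the product, and fails there by finitely many elements that vanish in K.

    In Cartier's theorem the obstacle is that the filtration by derivatives lying in I is not known
    to be the I-adic one, so Krull's theorem has no hold on it. On two copies of the variables,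
    Taylor expansion turns it into powers of the ideal of the diagonal. The way back rests on K
    being a field: I has a linear complement in the polynomial ring, so the second copy modulo I
    stays free over the first. *)

Lemma sum_delta (S : pzRingType) (I : finType) (j : I) (a : I -> S) :
  \sum_k a k * (k == j)%:R = a j.
Proof.
rewrite (bigD1 j) //= eqxx mulr1 big1 ?addr0 // => k /negbTE->.
exact: mulr0.
Qed.

Record ideal (S : comPzRingType) := Ideal {
  in_ideal :> S -> Prop;
  ideal0 : in_ideal 0;
  idealD : forall x y, in_ideal x -> in_ideal y -> in_ideal (x + y);
  idealM : forall a x, in_ideal x -> in_ideal (a * x) }.

Section Factor.
Variables (S A T : comPzRingType) (pi : {rmorphism S -> A}) (h : {rmorphism S -> T}).
Hypothesis pi_surj : forall y, exists x, pi x = y.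
Hypothesis pi_ker : forall x, pi x = 0 -> h x = 0.

Definition factor_fun (y : A) : T := h (projT1 (cid (pi_surj y))).

Lemma factor_funE x : factor_fun (pi x) = h x.
Proof.
apply/subr0_eq; rewrite -rmorphB pi_ker // rmorphB.
by rewrite (projT2 (cid (pi_surj (pi x)))) subrr.
Qed.

Lemma factor_zmod_morphism : zmod_morphism factor_fun.
Proof.
move=> x y; have [[x' <-] [y' <-]] := (pi_surj x, pi_surj y).
by rewrite -rmorphB !factor_funE rmorphB.
Qed.

Lemma factor_monoid_morphism : monoid_morphism factor_fun.
Proof.
split=> [|x y]; first by rewrite -(rmorph1 pi) factor_funE rmorph1.
have [[x' <-] [y' <-]] := (pi_surj x, pi_surj y).
by rewrite -rmorphM !factor_funE rmorphM.
Qed.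

HB.instance Definition _ :=
  GRing.isZmodMorphism.Build A T factor_fun factor_zmod_morphism.
HB.instance Definition _ :=
  GRing.isMonoidMorphism.Build A T factor_fun factor_monoid_morphism.

Definition factor : {rmorphism A -> T} := factor_fun.

Lemma factorE x : factor (pi x) = h x.
Proof. exact: factor_funE. Qed.

End Factor.

Section IdealTheory.
Variables (S : comPzRingType) (D : ideal S).

Lemma idealMr a x : D x -> D (x * a).
Proof. by rewrite mulrC; apply: idealM. Qed.

Lemma idealN x : D x -> D (- x).
Proof. by rewrite -mulN1r; apply: idealM. Qed.

Lemma idealB x y : D x -> D y -> D (x - y).
Proof. by move=> Dx /idealN; apply: idealD. Qed.

Lemma ideal_sum (I : Type) (r : seq I) (P : pred I) F :
  (forall i, P i -> D (F i)) -> D (\sum_(i <- r | P i) F i).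
Proof. by move=> DF; apply: big_ind => //; [apply: ideal0|apply: idealD]. Qed.

Lemma ideal_sym x y : D (x - y) -> D (y - x).
Proof. by move=> /idealN; rewrite opprB. Qed.

Lemma ideal_trans y x z : D (x - y) -> D (y - z) -> D (x - z).
Proof. by move=> Dxy /(idealD Dxy); rewrite addrA subrK. Qed.

Lemma ideal_eqM a b x y : D (a - b) -> D (x - y) -> D (a * x - b * y).
Proof.
move=> Dab Dxy; apply: (@ideal_trans (b * x)).
  by rewrite -mulrBl; apply: idealMr.
by rewrite -mulrBr; apply: idealM.
Qed.

Lemma ideal_eq_sum (I : Type) (r : seq I) (P : pred I) (F F' : I -> S) :
  (forall i, P i -> D (F i - F' i)) ->
  D (\sum_(i <- r | P i) F i - \sum_(i <- r | P i) F' i).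
Proof. by move=> DF; rewrite -sumrB; apply: ideal_sum. Qed.

Lemma ideal_congr x y : D (x - y) -> D y -> D x.
Proof. by move=> Dxy /(idealD Dxy); rewrite subrK. Qed.

Definition quo_rel : rel S := fun x y => `[< D (x - y) >].

Lemma quo_rel_equiv : equiv_class_of quo_rel.
Proof.
split=> [x|x y|y x z].
- by apply/asboolP; rewrite subrr; apply: ideal0.
- by apply/asboolP/asboolP; apply: ideal_sym.
- by move=> /asboolP xy /asboolP yz; apply/asboolP; apply: ideal_trans yz.
Qed.

Canonical quo_rel_canonical := EquivRelPack quo_rel_equiv.

Definition quo := {eq_quot quo_rel}.

HB.instance Definition _ := Choice.on quo.

Definition to_quo (x : S) : quo := \pi x.

Lemma to_quoE x y : to_quo x = to_quo y <-> D (x - y).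
Proof. by split=> [/eqmodP/asboolP //|Dxy]; apply/eqmodP/asboolP. Qed.

Lemma to_quo_surj (x : quo) : exists y, to_quo y = x.
Proof. by exists (repr x); apply: reprK. Qed.

Definition quo_add (x y : quo) : quo := to_quo (repr x + repr y).
Definition quo_opp (x : quo) : quo := to_quo (- repr x).
Definition quo_mul (x y : quo) : quo := to_quo (repr x * repr y).

Lemma repr_to_quo x : D (repr (to_quo x) - x).
Proof. by apply/to_quoE; apply: reprK. Qed.

Lemma quo_addE x y : quo_add (to_quo x) (to_quo y) = to_quo (x + y).
Proof.
by apply/to_quoE; rewrite opprD addrACA; apply: idealD; apply: repr_to_quo.
Qed.

Lemma quo_oppE x : quo_opp (to_quo x) = to_quo (- x).
Proof.
by apply/to_quoE; rewrite opprK addrC -opprB; apply/idealN/repr_to_quo.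
Qed.

Lemma quo_mulE x y : quo_mul (to_quo x) (to_quo y) = to_quo (x * y).
Proof. by apply/to_quoE; apply: ideal_eqM; apply: repr_to_quo. Qed.

Lemma quo_addA : associative quo_add.
Proof.
move=> x y z; have [[[x' <-] [y' <-]] [z' <-]] :=
  (to_quo_surj x, to_quo_surj y, to_quo_surj z).
by rewrite !quo_addE addrA.
Qed.

Lemma quo_addC : commutative quo_add.
Proof. by move=> x y; rewrite /quo_add addrC. Qed.

Lemma quo_add0 : left_id (to_quo 0) quo_add.
Proof. by move=> x; have [x' <-] := to_quo_surj x; rewrite quo_addE add0r. Qed.

Lemma quo_addN : left_inverse (to_quo 0) quo_opp quo_add.
Proof.
by move=> x; have [x' <-] := to_quo_surj x; rewrite quo_oppE quo_addE addNr.
Qed.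

HB.instance Definition _ := GRing.isZmodule.Build quo
  quo_addA quo_addC quo_add0 quo_addN.

Lemma quo_mulA : associative quo_mul.
Proof.
move=> x y z; have [[[x' <-] [y' <-]] [z' <-]] :=
  (to_quo_surj x, to_quo_surj y, to_quo_surj z).
by rewrite !quo_mulE mulrA.
Qed.

Lemma quo_mulC : commutative quo_mul.
Proof. by move=> x y; rewrite /quo_mul mulrC. Qed.

Lemma quo_mul1 : left_id (to_quo 1) quo_mul.
Proof. by move=> x; have [x' <-] := to_quo_surj x; rewrite quo_mulE mul1r. Qed.

Lemma quo_mulDl : left_distributive quo_mul quo_add.
Proof.
move=> x y z; have [[[x' <-] [y' <-]] [z' <-]] :=
  (to_quo_surj x, to_quo_surj y, to_quo_surj z).
by rewrite quo_addE !quo_mulE quo_addE mulrDl.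
Qed.

HB.instance Definition _ := GRing.Zmodule_isComPzRing.Build quo
  quo_mulA quo_mulC quo_mul1 quo_mulDl.

Lemma to_quo_zmod_morphism : zmod_morphism to_quo.
Proof.
move=> x y; rewrite -quo_addE; congr quo_add; exact/esym/quo_oppE.
Qed.

Lemma to_quo_monoid_morphism : monoid_morphism to_quo.
Proof. by split=> // x y; rewrite -quo_mulE. Qed.

HB.instance Definition _ :=
  GRing.isZmodMorphism.Build S quo to_quo to_quo_zmod_morphism.
HB.instance Definition _ :=
  GRing.isMonoidMorphism.Build S quo to_quo to_quo_monoid_morphism.

Lemma to_quo_eq0 x : to_quo x = 0 <-> D x.
Proof. by rewrite -(rmorph0 to_quo) to_quoE subr0. Qed.

Definition quo_lift (T : comPzRingType) (h : {rmorphism S -> T})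
    (hD : forall x, D x -> h x = 0) : {rmorphism quo -> T} :=
  factor to_quo_surj (fun x => hD x \o (to_quo_eq0 x).1).

Lemma quo_liftE (T : comPzRingType) (h : {rmorphism S -> T}) hD x :
  quo_lift (h := h) hD (to_quo x) = h x.
Proof. exact: factorE. Qed.

End IdealTheory.

Section Span.
Variables (S : comPzRingType) (m : nat) (f : 'I_m -> S).

Definition ideal_span_pred (x : S) : Prop := exists c : 'I_m -> S, x = \sum_i c i * f i.

Definition ideal_span : ideal S.
Proof.
apply: (@Ideal S ideal_span_pred) => [|_ _ [c ->] [d ->]|a _ [c ->]].
- by exists (fun=> 0); rewrite big1 // => i _; rewrite mul0r.
- exists (fun i => c i + d i); rewrite -big_split.
  by apply: eq_bigr => i _; rewrite mulrDl.
- exists (fun i => a * c i); rewrite mulr_sumr.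
  by apply: eq_bigr => i _; rewrite mulrA.
Defined.

Lemma ideal_span_gen i : ideal_span (f i).
Proof.
exists (fun j => (j == i)%:R); rewrite (bigD1 i) //= eqxx mul1r.
by rewrite big1 ?addr0 // => j /negbTE->; rewrite mul0r.
Qed.

Lemma ideal_span_min (D : ideal S) x : (forall i, D (f i)) -> ideal_span x -> D x.
Proof. by move=> Df [c ->]; apply: ideal_sum => i _; apply: idealM. Qed.

End Span.

Section Generated.
Variables (S : comPzRingType) (X : S -> Prop).

Definition generated : ideal S.
Proof.
apply: (@Ideal S (fun x => forall D : ideal S, (forall y, X y -> D y) -> D x)).
- by move=> D _; apply: ideal0.
- by move=> x y gx gy D XD; apply: idealD; [apply: gx|apply: gy].
- by move=> a x gx D XD; apply: idealM; apply: gx.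
Defined.

Lemma generated_gen x : X x -> generated x.
Proof. by move=> Xx D; apply. Qed.

Lemma generated_min (D : ideal S) x :
  (forall y, X y -> D y) -> generated x -> D x.
Proof. by move=> XD; apply. Qed.

End Generated.

Section IdealOperations.
Variables (S : comPzRingType) (D E : ideal S).

Definition ideal_sum2 : ideal S.
Proof.
apply: (@Ideal S (fun x => exists2 y, D y & E (x - y))).
- by exists 0; [apply: ideal0|rewrite subr0; apply: ideal0].
- move=> x y [x' Dx Ex] [y' Dy Ey]; exists (x' + y'); first exact: idealD.
  by rewrite opprD addrACA; apply: idealD.
- move=> a x [y Dy Exy]; exists (a * y); first exact: idealM.
  by rewrite -mulrBr; apply: idealM.
Defined.

Definition ideal_prod : ideal S :=
  generated (fun x => exists y z, [/\ D y, E z & x = y * z]).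

Lemma ideal_prod_gen x y : D x -> E y -> ideal_prod (x * y).
Proof. by move=> Dx Ey; apply: generated_gen; exists x, y. Qed.

End IdealOperations.

Definition ideal_preim (S T : comPzRingType) (h : {rmorphism S -> T})
  (D : ideal T) : ideal S.
Proof.
apply: (@Ideal S (fun x => D (h x))) => [|x y Dx Dy|a x Dx].
- by rewrite rmorph0; apply: ideal0.
- by rewrite rmorphD; apply: idealD.
- by rewrite rmorphM; apply: idealM.
Defined.

(** Explicit coefficients make membership in the square of an ideal an identity that ring maps can
    transport; hence the quadratic term of [smooth_certificate]. *)
Lemma ideal_span_prodP (S : comPzRingType) m (f : 'I_m -> S) x :
  ideal_prod (ideal_span f) (ideal_span f) x ->
  exists c : 'I_m -> 'I_m -> S, x = \sum_a \sum_b c a b * f a * f b.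
Proof.
pose X x := exists c : 'I_m -> 'I_m -> S, x = \sum_a \sum_b c a b * f a * f b.
have XI : X 0 /\ (forall x y, X x -> X y -> X (x + y)) /\
          forall a x, X x -> X (a * x).
  split; [|split].
  - exists (fun _ _ => 0); rewrite big1 // => a _; rewrite big1 // => b _.
    by rewrite !mul0r.
  - move=> _ _ [c ->] [d ->]; exists (fun a b => c a b + d a b).
    rewrite -big_split; apply: eq_bigr => a _; rewrite -big_split.
    by apply: eq_bigr => b _; rewrite !mulrDl.
  - move=> t _ [c ->]; exists (fun a b => t * c a b).
    rewrite mulr_sumr; apply: eq_bigr => a _; rewrite mulr_sumr.
    by apply: eq_bigr => b _; rewrite !mulrA.
case: XI => X0 [XD XM].
apply: (@generated_min _ _ (Ideal X0 XD XM)) => _ [_ [_ [[c ->] [d ->] ->]]].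
exists (fun a b => c a * d b); rewrite mulr_suml; apply: eq_bigr => a _.
rewrite mulr_sumr; apply: eq_bigr => b _.
by rewrite mulrACA -!mulrA.
Qed.

Section LinearExtension.
Variables (n : nat) (R : comNzRingType) (S : comPzRingType).
Variables (phi : {rmorphism R -> S}) (w : 'X_{1..n} -> S).

(** The extension, semilinear along [phi], of an arbitrary function on monomials. It serves for
    evaluation, and also for the reduction to normal form, which is not multiplicative. *)
Definition mlinear_ext (p : {mpoly R[n]}) : S :=
  \sum_(m <- msupp p) phi p@_m * w m.

Lemma mlinear_extE k (p : {mpoly R[n]}) : (msize p <= k)%N ->
  mlinear_ext p = \sum_(m : 'X_{1..n < k}) phi p@_m * w m.
Proof.
move=> le_pk; rewrite /mlinear_ext.
rewrite (big_mksub ('X_{1..n < k} : subFinType _)) ?msupp_uniq //=; last first.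
  by move=> x /msize_mdeg_lt /leq_trans; apply.
rewrite big_rmcond //= => j /memN_msupp_eq0 ->.
by rewrite rmorph0 mul0r.
Qed.

Lemma mlinear_ext_zmod_morphism : zmod_morphism mlinear_ext.
Proof.
move=> p r; set k := maxn (msize p) (maxn (msize r) (msize (p - r))).
rewrite !(@mlinear_extE k) ?leq_max ?leqnn ?orbT // -sumrB.
by apply: eq_bigr => m _; rewrite mcoeffB rmorphB mulrBl.
Qed.

HB.instance Definition _ := GRing.isZmodMorphism.Build {mpoly R[n]} S
  mlinear_ext mlinear_ext_zmod_morphism.

Lemma mlinear_extX m : mlinear_ext 'X_[m] = w m.
Proof. by rewrite /mlinear_ext msuppX big_seq1 mcoeffX eqxx rmorph1 mul1r. Qed.

Lemma mlinear_extZ c p : mlinear_ext (c *: p) = phi c * mlinear_ext p.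
Proof.
rewrite !(@mlinear_extE (msize p)) ?msizeZ_le // mulr_sumr.
by apply: eq_bigr => m _; rewrite mcoeffZ rmorphM mulrA.
Qed.

End LinearExtension.

(* Evaluation of polynomials at points of possibly zero rings, which [mmap]
   does not allow. *)
Section Evaluation.
Variables (n : nat) (R : comNzRingType) (S : comPzRingType).
Variables (phi : {rmorphism R -> S}) (q : 'I_n -> S).

Definition meval_at : {mpoly R[n]} -> S :=
  mlinear_ext phi (fun m => \prod_i q i ^+ m i).

HB.instance Definition _ := GRing.Additive.on meval_at.

Lemma meval_atZX c m :
  meval_at (c *: 'X_[m]) = phi c * \prod_i q i ^+ m i.
Proof. by rewrite /meval_at mlinear_extZ mlinear_extX. Qed.

Lemma meval_at_monoid_morphism : monoid_morphism meval_at.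
Proof.
split=> [|p r].
  rewrite -[1](scale1r (1 : {mpoly R[n]})) -mpolyX0 meval_atZX rmorph1 mul1r.
  by rewrite big1 // => i _; rewrite mnm0E expr0.
rewrite [p]mpolyE [r]mpolyE big_distrlr /= !raddf_sum big_distrlr /=.
apply: eq_bigr => m _; rewrite raddf_sum; apply: eq_bigr => m' _ /=.
rewrite -scalerAl -scalerAr -mpolyXD scalerA !meval_atZX rmorphM mulrACA.
congr (_ * _); rewrite -big_split; apply: eq_bigr => i _ /=.
by rewrite mnmDE exprD.
Qed.

HB.instance Definition _ := GRing.isMonoidMorphism.Build {mpoly R[n]} S
  meval_at meval_at_monoid_morphism.

Lemma meval_atC c : meval_at c%:MP = phi c.
Proof.
rewrite -[c%:MP]mulr1 -mpolyX0 mul_mpolyC meval_atZX big1 ?mulr1 // => i _.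
by rewrite mnm0E expr0.
Qed.

Lemma meval_atX i : meval_at 'X_i = q i.
Proof.
rewrite -[X in meval_at X]scale1r meval_atZX rmorph1 mul1r (bigD1 i) //=.
rewrite mnm1E eqxx expr1 big1 ?mulr1 // => j ji.
by rewrite mnm1E eq_sym (negbTE ji) expr0.
Qed.

End Evaluation.

Lemma mpoly_morph_ext n (R : comNzRingType) (S : comPzRingType)
    (g h : {rmorphism {mpoly R[n]} -> S}) :
  (forall c, g c%:MP = h c%:MP) -> (forall i, g 'X_i = h 'X_i) -> g =1 h.
Proof.
move=> ghC ghX p; rewrite [p]mpolyE !rmorph_sum; apply: eq_bigr => m _.
rewrite -mul_mpolyC !rmorphM ghC mpolyXE_id !rmorph_prod; congr (_ * _).
by apply: eq_bigr => i _; rewrite !rmorphXn ghX.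
Qed.

Lemma meval_at_morph n (R : comNzRingType) (S T : comPzRingType)
    (phi : {rmorphism R -> S}) (h : {rmorphism S -> T}) (q : 'I_n -> S) p :
  h (meval_at phi q p) = meval_at (h \o phi) (h \o q) p.
Proof.
apply: (mpoly_morph_ext (g := h \o meval_at phi q)) => [c|i] /=.
  by rewrite !meval_atC.
by rewrite !meval_atX.
Qed.

Lemma meval_at_map n (R R' : comNzRingType) (S : comPzRingType)
    (chi : {rmorphism R -> R'}) (phi : {rmorphism R' -> S}) (q : 'I_n -> S) p :
  meval_at phi q (map_mpoly chi p) = meval_at (phi \o chi) q p.
Proof.
apply: (mpoly_morph_ext (g := meval_at phi q \o map_mpoly chi)) => [c|i] /=.
  by rewrite map_mpolyC !meval_atC.
by rewrite map_mpolyX !meval_atX.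
Qed.

Lemma eq_meval_at n (R : comNzRingType) (S : comPzRingType)
    (phi phi' : {rmorphism R -> S}) (q q' : 'I_n -> S) p :
  phi =1 phi' -> q =1 q' -> meval_at phi q p = meval_at phi' q' p.
Proof.
move=> e e'.
apply: (mpoly_morph_ext (g := meval_at phi q) (h := meval_at phi' q')) => [c|i].
  by rewrite /= !meval_atC ?e.
by rewrite /= !meval_atX ?e'.
Qed.

Lemma mpoly_ring_ind n (R : comNzRingType) (P : {mpoly R[n]} -> Prop) :
  (forall c, P c%:MP) -> (forall i, P 'X_i) ->
  (forall p q, P p -> P q -> P (p + q)) ->
  (forall p q, P p -> P q -> P (p * q)) -> forall p, P p.
Proof.
move=> PC PX PD PM p; rewrite [p]mpolyE.
apply: (big_ind P) => [|//|m _]; first by rewrite -mpolyC0.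
rewrite -mul_mpolyC; apply: (PM _ _) => //; rewrite mpolyXE_id.
apply: (big_ind P) => [|//|i _]; first by rewrite -mpolyC1.
elim: (m i) => [|d IHd]; first by rewrite expr0 -mpolyC1.
by rewrite exprS; apply: PM.
Qed.

Lemma mderivXU n (R : comNzRingType) (i j : 'I_n) :
  ('X_j : {mpoly R[n]})^`M(i) = (j == i)%:R.
Proof.
rewrite mderivX mnm1E; case: eqVneq => [->|_]; last by rewrite scale0r.
by rewrite scale1r -{1}[U_(i)%MM]add0m addmK mpolyX0.
Qed.

(** Derivations along a ring map [theta] cover both partial derivatives, with [theta] the identity,
    and linear parts, with [theta] the constant part. *)
Lemma chain_rule n (R : comNzRingType) (S T : comPzRingType)
    (phi : {rmorphism R -> S}) (theta : {rmorphism S -> T}) (d : {additive S -> T})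
    (w : 'I_n -> S) :
  (forall a b, d (a * b) = d a * theta b + theta a * d b) ->
  (forall c, d (phi c) = 0) ->
  forall p, d (meval_at phi w p) =
    \sum_i theta (meval_at phi w p^`M(i)) * d (w i).
Proof.
move=> dM dC; apply: mpoly_ring_ind => [c|j|p q IHp IHq|p q IHp IHq].
- by rewrite meval_atC dC big1 // => i _; rewrite mderivC !rmorph0 mul0r.
- rewrite meval_atX (bigD1 j) //= mderivXU eqxx !rmorph1 mul1r.
  rewrite big1 ?addr0 // => i ij.
  by rewrite mderivXU eq_sym (negbTE ij) !rmorph0 mul0r.
- rewrite !rmorphD raddfD IHp IHq -big_split; apply: eq_bigr => i _ /=.
  by rewrite mderivD !rmorphD mulrDl.
- rewrite rmorphM dM IHp IHq mulr_suml mulr_sumr -big_split.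
  apply: eq_bigr => i _ /=.
  by rewrite mderivM rmorphD rmorphD !rmorphM mulrDl mulrAC mulrA.
Qed.

(** * Noetherian rings and Krull's intersection theorem *)

Definition noetherian (S : comPzRingType) : Prop :=
  forall D : ideal S, exists s : seq S,
    (forall x, x \in s -> D x) /\
    (forall x, D x -> generated (fun y => y \in s) x).

Definition ideal_colon (S : comPzRingType) (C : ideal S) (a : S) : ideal S.
Proof.
apply: (@Ideal S (fun x => C (a * x))) => [|x y Cx Cy|c x Cx].
- by rewrite mulr0; apply: ideal0.
- by rewrite mulrDr; apply: idealD.
- by rewrite mulrCA; apply: idealM.
Defined.

Section UnionOfChain.
Variables (S : comPzRingType) (C : nat -> ideal S).
Hypothesis C_chain : forall k x, C k x -> C k.+1 x.

Lemma chain_le j k x : (j <= k)%N -> C j x -> C k x.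
Proof.
move=> /subnKC <-; elim: (k - j)%N x => [|d IHd] x Cx; first by rewrite addn0.
by rewrite addnS; apply/C_chain/IHd.
Qed.

Definition chain_union : ideal S.
Proof.
apply: (@Ideal S (fun x => exists k, C k x)) => [|x y [j Cx] [k Cy]|a x [k Cx]].
- by exists 0; apply: ideal0.
- exists (maxn j k); apply: idealD.
    by apply: chain_le Cx; apply: leq_maxl.
  by apply: chain_le Cy; apply: leq_maxr.
- by exists k; apply: idealM.
Defined.

Lemma noetherian_chain : noetherian S ->
  exists k, forall j x, C j x -> C k x.
Proof.
move=> /(_ chain_union)[s [sU Us]].
have [k sk] : exists k, forall x, x \in s -> C k x.
  elim: s sU {Us} => [|y s IHs] sU; first by exists 0.
  have [|k sk] := IHs; first by move=> x xs; apply: sU; rewrite inE xs orbT.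
  have [j Cy] := sU y (mem_head _ _).
  exists (maxn j k) => x; rewrite inE => /orP[/eqP->|xs].
    by apply: chain_le Cy; apply: leq_maxl.
  by apply: chain_le (sk _ xs); apply: leq_maxr.
exists k => j x Cjx; have /Us gx : chain_union x by exists j.
exact: generated_min gx.
Qed.

End UnionOfChain.

Lemma noetherian_max (S : comPzRingType) (P : ideal S -> Prop) (C0 : ideal S) :
  noetherian S -> P C0 ->
  exists2 C, P C & forall C', P C' -> (forall x, C x -> C' x) ->
    forall x, C' x -> C x.
Proof.
move=> noethS PC0; apply: contrapT => nomax.
have nextP (C : {C : ideal S | P C}) : exists C' : {C : ideal S | P C},
    (forall x, sval C x -> sval C' x) /\ exists2 x, sval C' x & ~ sval C x.
  apply: contrapT => Cmax; apply: nomax; case: C Cmax => C PC /= Cmax.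
  exists C => // C' PC' CC' x C'x; apply: contrapT => nCx; apply: Cmax.
  by exists (exist _ C' PC'); split=> //; exists x.
have [nxt nxtP] := choice nextP.
pose C k := iter k nxt (exist _ C0 PC0).
have [|k Ck] := @noetherian_chain S (fun k => sval (C k)) _ noethS.
  by move=> k; have [] := nxtP (C k).
by have [_ [x C'x]] := nxtP (C k); apply; apply: (Ck k.+1).
Qed.

Section Krull.
Variables (S : comPzRingType) (n : nat) (z : 'I_n -> S) (B : ideal S) (F : S).
Hypothesis noethS : noetherian S.
Hypothesis F_small : forall k,
  exists2 b, B b & ideal_span (fun i => z i ^+ k) (F - b).

Let zF : ideal S.
Proof.
apply: (@Ideal S (fun x => exists2 a, ideal_span z a & B (x - a * F))).
- by exists 0; [apply: ideal0|rewrite mul0r subr0; apply: ideal0].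
- move=> x y [a za Bx] [b zb By]; exists (a + b); first exact: idealD.
  by rewrite mulrDl opprD addrACA; apply: idealD.
- move=> c x [a za Bx]; exists (c * a); first exact: idealM.
  by rewrite -mulrA -mulrBr; apply: idealM.
Defined.

(** The claim is that F lies in (z)F + B, which is [zF]. A maximal ideal C among those that contain
    [zF] and meet (F) only inside [zF] contains a power of every [z i]. By [F_small] it then
    contains F, which is in (F) and therefore in [zF]. *)
Lemma krull_intersection : exists2 a, ideal_span z a & B ((1 - a) * F).
Proof.
pose good (C : ideal S) :=
  (forall x, zF x -> C x) /\ forall t, C (t * F) -> zF (t * F).
have [|C [zFC CF] Cmax] := @noetherian_max _ good zF noethS.
  by split.
(* Once the colon ideals of C by the powers of [z i] are stationary at k, adding [z i ^+ k] to C
   keeps it good: if tF = c + u z^k, then z^(k+1) u = z t F - z c lies in C, hence so does z^k u.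
   Maximality gives the power. *)
have pow i : exists k, C (z i ^+ k).
  have [|k Qk] := @noetherian_chain _ (fun k => ideal_colon C (z i ^+ k)) _ noethS.
    by move=> k x Cx; rewrite /= exprS -mulrA; apply: idealM.
  exists k; pose z1 (_ : 'I_1) := z i ^+ k.
  have Cz1 x : C x -> ideal_sum2 C (ideal_span z1) x.
    by exists x => //; rewrite subrr; apply: ideal0.
  apply: (Cmax (ideal_sum2 C (ideal_span z1))) => //; last first.
    by exists 0; [apply: ideal0|rewrite subr0; apply: (ideal_span_gen z1 ord0)].
  split=> [x /zFC/Cz1 //|t [c Cc [u]]].
  rewrite big_ord1 => tF; apply: CF.
  suff Cu : C (u ord0 * z1 ord0) by move/eqP: tF; rewrite subr_eq => /eqP ->; apply: idealD.
  rewrite mulrC; apply: (Qk k.+1); rewrite /= exprS -mulrA.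
  have -> : z i ^+ k * u ord0 = t * F - c by rewrite tF mulrC.
  rewrite mulrBr; apply: idealB; last exact: idealM.
  apply: zFC; exists (z i * t); last by rewrite mulrA subrr; apply: ideal0.
  by apply: idealMr; apply: ideal_span_gen.
have [k kP] := choice pow; pose K := \max_i k i.
have [b Bb zFb] := F_small K.
have CFb : C (F - b).
  apply: ideal_span_min zFb => i; have /subnK <- : (k i <= K)%N by apply: leq_bigmax.
  by rewrite exprD; apply: idealM.
have /CF : C (1 * F).
  rewrite mul1r -(subrK b F); apply: idealD => //; apply: zFC.
  by exists 0; [apply: ideal0|rewrite mul0r subr0].
case=> a za; rewrite -mulrBl => BF; by exists a.
Qed.

End Krull.

(** * Hilbert's basis theorem *)

Section HilbertBasis.
Variable R : comNzRingType.

Definition lead_ideal (E : ideal {poly R}) (e : nat) : ideal R.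
Proof.
apply: (@Ideal R (fun a => exists q, [/\ E q, (size q <= e.+1)%N & q`_e = a])).
- by exists 0; split; [apply: ideal0|rewrite size_poly0|rewrite coef0].
- move=> _ _ [p [Ep sp <-]] [q [Eq sq <-]]; exists (p + q); split.
  + exact: idealD.
  + by rewrite (leq_trans (size_polyD _ _)) // geq_max sp.
  + by rewrite coefD.
- move=> a _ [p [Ep sp <-]]; exists (a%:P * p); split.
  + exact: idealM.
  + by rewrite mul_polyC (leq_trans (size_scale_leq _ _)).
  + by rewrite coefCM.
Defined.

Lemma lead_idealS E e a : lead_ideal E e a -> lead_ideal E e.+1 a.
Proof.
case=> q [Eq sq <-]; exists ('X * q); split; first exact: idealM.
  by rewrite mulrC; have [->|q0] := eqVneq q 0;
    rewrite ?mul0r ?size_poly0 // size_mulX.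
by rewrite coefXM.
Qed.

(** Induction on the degree: an element of E with the same leading coefficient is subtracted. *)
Lemma sub_lead_ideal (D E : ideal {poly R}) :
  (forall x, E x -> D x) ->
  (forall e a, lead_ideal D e a -> lead_ideal E e a) -> forall p, D p -> E p.
Proof.
move=> ED leadDE p; have [k] := ubnP (size p); elim: k p => // k IHk p.
rewrite ltnS; case sp: (size p) => [|e] lt_e Dp.
  by move/eqP: sp; rewrite size_poly_eq0 => /eqP->; apply: ideal0.
have [|q [Eq sq qe]] := leadDE e p`_e; first by exists p; rewrite sp.
rewrite -(subrK q p); apply: idealD => //; apply: IHk; last first.
  by apply: idealB => //; apply: ED.
apply: leq_trans lt_e; rewrite ltnS; apply/leq_sizeP => j.
rewrite leq_eqVlt => /orP[/eqP<-|lt_ej]; first by rewrite coefB qe subrr.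
rewrite coefB !nth_default ?subrr // ?sp //.
exact: leq_trans sq lt_ej.
Qed.

Lemma noetherian_poly : noetherian R -> noetherian {poly R}.
Proof.
move=> noethR D.
have fg e : exists s : seq {poly R}, (forall p, p \in s -> D p) /\
    forall E : ideal {poly R}, (forall p, p \in s -> E p) ->
    forall a, lead_ideal D e a -> lead_ideal E e a.
  have [t [tD Dt]] := noethR (lead_ideal D e).
  have [s [sD st]] : exists s : seq {poly R}, (forall p, p \in s -> D p) /\
      forall a, a \in t -> exists p, [/\ p \in s, (size p <= e.+1)%N & p`_e = a].
    elim: t tD {Dt} => [|a t IHt] tD; first by exists [::].
    have [|s [sD st]] := IHt; first by move=> x xt; apply: tD; rewrite inE xt orbT.
    have [p [Dp sp pa]] := tD a (mem_head _ _).
    exists (p :: s); split=> [q|b]; rewrite inE => /orP[/eqP->//|].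
    - exact: sD.
    - by exists p; rewrite mem_head.
    - by move/st => [q [qs sq qb]]; exists q; rewrite inE qs orbT.
  exists s; split=> // E sE a /Dt; apply: generated_min => b /st[p [ps sp pb]].
  by exists p; split=> //; apply: sE.
have [s sP] := choice fg.
have [d dP] := @noetherian_chain R (lead_ideal D) (@lead_idealS D) noethR.
(* Generators for the degrees up to d suffice: beyond d the leading coefficients are those of degree
   d, reached by multiplication by the variable. *)
pose r := flatten [seq s e | e <- iota 0 d.+1].
have srE e p : (e <= d)%N -> p \in s e -> p \in r.
  move=> le_ed pe; apply/flatten_mapP; exists e => //.
  by rewrite mem_iota add0n ltnS.
exists r; split=> [p /flatten_mapP[e _ pe]|]; first by have [sD _] := sP e; apply: sD.
apply: sub_lead_ideal => [x|e a lead_a].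
  by apply: generated_min => p /flatten_mapP[e _ pe]; have [sD _] := sP e; apply: sD.
have lead_le e' : (e' <= d)%N -> lead_ideal D e' a ->
    lead_ideal (generated (fun y => y \in r)) e' a.
  move=> le_e'd; have [_ sE] := sP e'; apply: sE => p pe'.
  by apply: generated_gen; apply: srE pe'.
have [/lead_le|lt_de] := leqP e d; first exact.
apply: chain_le (ltnW lt_de) _; first exact: lead_idealS.
exact/lead_le/dP/lead_a.
Qed.

End HilbertBasis.

Lemma noetherian_surj (S T : comPzRingType) (h : {rmorphism S -> T}) :
  (forall y, exists x, h x = y) -> noetherian S -> noetherian T.
Proof.
move=> surj noethS D; have [s [sD Ds]] := noethS (ideal_preim h D).
exists [seq h x | x <- s]; split=> [_ /mapP[x xs ->]|y Dy]; first exact: sD.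
have [x hx] := surj y; rewrite -hx.
have /Ds : ideal_preim h D x by rewrite /= hx.
apply: (@generated_min _ _ (ideal_preim h (generated _))) => u us /=.
by apply: generated_gen; apply: map_f.
Qed.

(** S is an iterated univariate polynomial ring. Mapping it onto [{mpoly R[n]}] is enough to
    transfer noetherianity, so the two are compared by a surjection instead of an isomorphism. *)
Lemma noetherian_adjoin (R T : comNzRingType) (phi : {rmorphism R -> T})
    (q : seq T) : noetherian R ->
  exists (S : comNzRingType) (h : {rmorphism S -> T}),
    [/\ noetherian S, forall c, exists x, h x = phi c &
        forall y, y \in q -> exists x, h x = y].
Proof.
move=> noethR; elim: q => [|y q [S [h [noethS hphi hq]]]].
  by exists R, phi; split=> // c; exists c.
exists {poly S}, (horner_eval y \o map_poly h); split=> [|c|w].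
- exact: noetherian_poly.
- have [x hx] := hphi c; exists x%:P.
  by rewrite /= /horner_eval map_polyC hornerC.
- rewrite inE => /orP[/eqP->|/hq[x hx]].
    by exists 'X; rewrite /= /horner_eval map_polyX hornerX.
  by exists x%:P; rewrite /= /horner_eval map_polyC hornerC.
Qed.

Lemma noetherian_mpoly (R : comNzRingType) n :
  noetherian R -> noetherian {mpoly R[n]}.
Proof.
move=> noethR; pose q := [seq 'X_i | i : 'I_n] : seq {mpoly R[n]}.
have [S [h [noethS hC hX]]] :=
  noetherian_adjoin (mpolyC n (R := R) : {rmorphism R -> {mpoly R[n]}}) q noethR.
apply: noetherian_surj noethS => p.
pose im (p : {mpoly R[n]}) := exists x, h x = p.
have imM a b : im a -> im b -> im (a * b).
  by move=> [x <-] [y <-]; exists (x * y); rewrite rmorphM.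
rewrite [p]mpolyE; apply: (big_ind im) => [|a b [x <-] [y <-]|m _].
- by exists 0; rewrite rmorph0.
- by exists (x + y); rewrite rmorphD.
- rewrite -mul_mpolyC; apply: (imM _ _) => [|]; first exact: hC.
  rewrite mpolyXE_id; apply: (big_ind im) => [||i _].
  + by exists 1; rewrite rmorph1.
  + exact: imM.
  + have [x hx] : im 'X_i by apply: hX; apply: map_f; rewrite mem_enum.
    by exists (x ^+ m i); rewrite rmorphXn hx.
Qed.

Lemma noetherian_field (K : fieldType) : noetherian K.
Proof.
move=> D; have [[x Dx x0]|D0] := pselect (exists2 x, D x & x != 0).
  exists [:: x]; split=> [y|y _]; first by rewrite inE => /eqP->.
  rewrite -[y](divfK x0); apply: idealM; apply: generated_gen.
  exact: mem_head.
exists [::]; split=> // x Dx.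
have [->|x0] := eqVneq x 0; first exact: ideal0.
by case: D0; exists x.
Qed.

(** * Normal forms and descent along the diagonal *)

Section NormalForm.
Import Order.TTheory.
Variables (K : fieldType) (n : nat) (I : ideal {mpoly K[n]}).

(** Only standard monomials occur, those that lead no nonzero element of I. Leading monomials are
    taken over the whole of I instead of a Groebner basis. *)
Definition normal (r : {mpoly K[n]}) : Prop :=
  forall m, m \in msupp r -> forall g, I g -> g != 0 -> mlead g != m.

Lemma normal0 : normal 0.
Proof. by move=> m; rewrite msupp0. Qed.

Lemma normalD r s : normal r -> normal s -> normal (r + s).
Proof.
move=> nr ns m /msuppD_le; rewrite mem_cat => /orP[]; [exact: nr|exact: ns].
Qed.

Lemma normalZ c r : normal r -> normal (c *: r).
Proof.
by move=> nr m /(@msuppZ_le _ _ _ _ _); apply: nr.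
Qed.

Lemma normal_exists p : exists r, normal r /\ I (p - r).
Proof.
elim/mleadrect: p => p IHp.
have [->|p0] := eqVneq p 0.
  by exists 0; split; [apply: normal0|rewrite subrr; apply: ideal0].
have reduce g : g != 0 -> mlead g = mlead p -> exists r,
    normal r /\ I (p - (p@_(mlead p) / g@_(mlead p)) *: g - r).
  move=> g0 gp; set c := _ / _; set q := p - _.
  have [q0|q0] := eqVneq q 0.
    by exists 0; split; [apply: normal0|rewrite q0 subrr; apply: ideal0].
  apply: IHp; rewrite lt_neqAle; apply/andP; split.
    apply: contra q0 => /eqP qp; rewrite -mleadc_eq0 qp /q mcoeffB mcoeffZ.
    by rewrite divfK ?subrr // -gp mleadc_eq0.
  apply: le_trans (mleadB_le _ _) _; rewrite leUx lexx /=.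
  by rewrite -gp mleadZ_le.
have [[g [Ig g0 gp]]|std] := pselect (exists g, [/\ I g, g != 0 & mlead g = mlead p]).
  have [r [nr Ir]] := reduce g g0 gp; exists r; split=> //.
  rewrite addrAC in Ir; apply: (ideal_congr (y := _ *: g) Ir).
  by rewrite -mul_mpolyC; apply: idealM.
(* Here the leading monomial of p is standard: it is split off by [reduce], applied to the monomial
   itself, and kept in the normal form. *)
have [||r [nr Ir]] := reduce 'X_[mlead p]; first 2 last.
- eexists; split; last by rewrite -addrA -opprD in Ir; apply: Ir.
  apply: normalD => //; apply: normalZ => m /mem_msuppXP <- g Ig g0.
  by apply/eqP => gp; apply: std; exists g.
- by rewrite -msupp_eq0 msuppX.
- by rewrite mleadXm.
Qed.

Lemma normal_ideal0 r : normal r -> I r -> r = 0.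
Proof.
move=> nr Ir; apply/eqP; apply: contraT => r0.
by have := nr _ (mlead_supp r0) _ Ir r0; rewrite eqxx.
Qed.

(** A linear projection with kernel I. Additivity comes from uniqueness: a difference of two normal
    forms that lies in I is 0. *)
Lemma normal_form_exists : exists nu : {mpoly K[n]} -> {mpoly K[n]},
  [/\ forall p, I (p - nu p), forall p, I p -> nu p = 0,
      forall p q, nu (p + q) = nu p + nu q & forall c p, nu (c *: p) = c *: nu p].
Proof.
have [nu nuP] := choice normal_exists; exists nu.
have uniq r p : normal r -> I (p - r) -> nu p = r.
  move=> nr Ir; have [nnu Inu] := nuP p; apply/subr0_eq/normal_ideal0.
    by apply: normalD => //; rewrite -scaleN1r; apply: normalZ.
  by apply: (@ideal_trans _ I p) => //; apply: ideal_sym.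
split=> [p|p Ip|p q|c p].
- by have [] := nuP p.
- by apply: uniq; [apply: normal0|rewrite subr0].
- have [[np Ip] [nq Iq]] := (nuP p, nuP q).
  by apply: uniq; [apply: normalD|rewrite opprD addrACA; apply: idealD].
- have [np Ip] := nuP p.
  by apply: uniq; [apply: normalZ|rewrite -scalerBr -mul_mpolyC; apply: idealM].
Qed.

End NormalForm.

(** The extension of D to the polynomial ring, that is D placed in the first copy of the
    variables. *)
Definition coef_ideal (P : comNzRingType) n (D : ideal P) : ideal {mpoly P[n]}.
Proof.
apply: (@Ideal {mpoly P[n]} (fun t => forall m, D t@_m)) => [m|t u Dt Du m|t u Du m].
- by rewrite mcoeff0; apply: ideal0.
- by rewrite mcoeffD; apply: idealD.
- rewrite mpolyME raddf_sum; apply: ideal_sum => i _ /=.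
  by rewrite mcoeffZ -mulrA; apply: idealM; apply: idealMr.
Defined.

(* In [{mpoly {mpoly K[n]}[n]}] the coefficients are polynomials in a first
   copy x of the variables and the indeterminates form a second copy x'. *)
Section TwoCopies.
Variables (K : fieldType) (n : nat).
Local Notation P := {mpoly K[n]}.
Local Notation T := {mpoly P[n]}.
Variable I : ideal P.

Definition second : {rmorphism P -> T} := map_mpoly (mpolyC n (R := K)).

Definition diag : {rmorphism T -> P} := meval (fun i => 'X_i).

Lemma diagC p : diag p%:MP = p.
Proof. exact: mevalC. Qed.

Lemma diagX i : diag 'X_i = 'X_i.
Proof. exact: mevalXU. Qed.

Lemma secondX i : second 'X_i = 'X_i.
Proof. exact: map_mpolyX. Qed.

Lemma secondC c : second c%:MP = c%:MP%:MP.
Proof. exact: map_mpolyC. Qed.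

Lemma diag_second p : diag (second p) = p.
Proof.
apply: (mpoly_morph_ext (g := diag \o second) (h := idfun)) => [c|i] /=.
  by rewrite secondC diagC.
by rewrite secondX diagX.
Qed.

Definition second_ideal : ideal T :=
  generated (fun t => exists2 p, I p & t = second p).

Lemma diag_second_ideal t : second_ideal t -> I (diag t).
Proof.
apply: (@generated_min _ _ (ideal_preim diag I)) => _ [p Ip ->] /=.
by rewrite diag_second.
Qed.

(** If T is read as the tensor square of P, then N is the identity on the first factor tensored with
    the normal form on the second. Linearity over the first copy is what preserves [coef_ideal]. *)
Lemma second_reduction : exists N : {additive T -> T},
  [/\ forall t, second_ideal (t - N t), forall t, second_ideal t -> N t = 0,
      forall p t, N (p *: t) = p *: N t &
      forall (D : ideal P) t, coef_ideal n D t -> coef_ideal n D (N t)].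
Proof.
have [nu [nuI nu0 nuD nuZ]] := normal_form_exists I.
pose w m := second (nu 'X_[m]).
have [N [NX NZ]] : exists N : {additive T -> T},
    (forall m, N 'X_[m] = w m) /\ forall p t, N (p *: t) = p *: N t.
  exists (mlinear_ext (mpolyC n (R := P)) w); split=> [m|p t].
    exact: mlinear_extX.
  by rewrite -[RHS]mul_mpolyC; apply: mlinear_extZ.
have N_second p : N (second p) = second (nu p).
  rewrite {1}[p]mpolyE; have -> : nu p = \sum_(m <- msupp p) p@_m *: nu 'X_[m].
    have nu00 : nu 0 = 0 by apply: nu0; apply: ideal0.
    rewrite {1}[p]mpolyE; elim: (msupp p) => [|m s IHs]; rewrite ?big_nil // !big_cons.
    by rewrite nuD nuZ IHs.
  rewrite !(raddf_sum second) (raddf_sum N); apply: eq_bigr => m _ /=.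
  have sX : second 'X_[m] = 'X_[m] by apply: map_mpolyX.
  by rewrite -!mul_mpolyC !rmorphM !secondC sX mul_mpolyC NZ NX -mul_mpolyC.
exists N; split=> // [t|t st|D t Dt].
- rewrite [t]mpolyE (raddf_sum N) -sumrB; apply: ideal_sum => m _.
  rewrite NZ -scalerBr -mul_mpolyC; apply: idealM; apply: generated_gen.
  exists ('X_[m] - nu 'X_[m]) => //; rewrite rmorphB NX; congr (_ - _).
  exact/esym/map_mpolyX.
(* N is not T-linear, so its kernel is replaced by the largest ideal inside it, for which generators
   of [second_ideal] can be tested. *)
- have killI : {B : ideal T | forall x, B x <-> forall u, N (u * x) = 0}.
    unshelve eexists.
      apply: (@Ideal T (fun x => forall u, N (u * x) = 0)) => [u|x y Nx Ny u|a x Nx u].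
      - by rewrite mulr0 raddf0.
      - by rewrite mulrDr raddfD /= Nx Ny addr0.
      - by rewrite mulrA.
    by [].
  case: killI => B BE; rewrite -[t]mul1r; move: (1 : T); apply/BE.
  apply: generated_min st => _ [p Ip ->]; apply/BE => u.
  rewrite [u]mpolyE mulr_suml raddf_sum big1 // => m _ /=.
  have -> : 'X_[m] = second 'X_[m] by apply/esym/map_mpolyX.
  rewrite -scalerAl NZ -rmorphM N_second nu0 ?rmorph0 ?scaler0 //.
  exact: idealM.
- move=> m; rewrite [t]mpolyE !raddf_sum; apply: ideal_sum => k _ /=.
  by rewrite NZ mcoeffZ; apply: idealMr.
Qed.

(* Flatness of the second projection: an identity modulo the second copy of
   [I] can be tested on the coefficients of normal forms. *)
Lemma diagonal_descent (D : ideal P) (s : T) p :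
  (forall q, I q -> D (q * p)) ->
  I (1 - diag s) -> ideal_sum2 second_ideal (coef_ideal n D) (s * p%:MP) -> D p.
Proof.
move=> DI I1 [b Bb Db]; have [N [NI N0 NZ ND]] := second_reduction.
have DN : coef_ideal n D (p%:MP * N s).
  have -> : p%:MP * N s = N (s * p%:MP - b).
    by rewrite raddfB /= (N0 b) // subr0 mul_mpolyC -NZ -mul_mpolyC mulrC.
  exact: ND.
have Ddiag : D (diag (N s) * p).
  rewrite mulrC -{1}[p]diagC -rmorphM; set t := _ * _ in DN *.
  rewrite [t]mpolyE raddf_sum; apply: ideal_sum => m _ /=.
  by rewrite -mul_mpolyC rmorphM diagC; apply: idealMr.
(* On the diagonal, s and [N s] differ by an element of I, so 1 - [diag (N s)] is in I and
   multiplies p into D. *)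
suff : D ((1 - diag (N s)) * p).
  by move=> /idealD/(_ Ddiag); rewrite -mulrDl subrK mul1r.
apply: DI; apply: (ideal_trans I1); rewrite -(rmorphB diag).
exact: diag_second_ideal (NI s).
Qed.

End TwoCopies.

Arguments second {K n}.
Arguments diag {K n}.

(** * Differential powers of an ideal *)

Section DifferentialPowers.
Variables (K : fieldType) (n : nat) (I : ideal {mpoly K[n]}).
Implicit Types p q : {mpoly K[n]}.

(** The differential powers of I, indexed so that level 0 is I itself and level N contains the power
    N + 1 of I. *)
Fixpoint diff_power_pred (N : nat) p : Prop :=
  if N is N'.+1 then I p /\ forall i, diff_power_pred N' p^`M(i) else I p.

Lemma diff_power_sub N p : diff_power_pred N p -> I p.
Proof. by case: N => [|N] // []. Qed.

Lemma diff_powerS N p : diff_power_pred N.+1 p -> diff_power_pred N p.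
Proof.
elim: N p => [|N IHN] p [Ip Jp] //.
by split=> // i; apply: IHN.
Qed.

Definition diff_power (N : nat) : ideal {mpoly K[n]}.
Proof.
apply: (@Ideal {mpoly K[n]} (diff_power_pred N)).
- elim: N => [|N IHN] /=; first exact: ideal0.
  by split=> [|i]; [apply: ideal0|rewrite mderiv0].
- elim: N => [|N IHN] p q /=; first exact: idealD.
  move=> [Ip Jp] [Iq Jq]; split=> [|i]; first exact: idealD.
  by rewrite mderivD; apply: IHN.
- suff: (forall p q, diff_power_pred N p -> diff_power_pred N q ->
          diff_power_pred N (p + q)) /\
        forall a p, diff_power_pred N p -> diff_power_pred N (a * p) by case.
  elim: N => [|N [IHD IHM]] /=; first by split; [apply: idealD|apply: idealM].
  split=> [p q [Ip Jp] [Iq Jq]|a p Jp].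
    by split=> [|i]; [apply: idealD|rewrite mderivD; apply: IHD].
  have Jp' := diff_powerS Jp; case: Jp => Ip Jp.
  split=> [|i]; first exact: idealM.
  by rewrite mderivM; apply: IHD; apply: IHM.
Defined.

Lemma diff_powerM N a p : I a -> diff_power N p -> diff_power N.+1 (a * p).
Proof.
elim: N a p => [|N IHN] a p Ia Jp.
  by split=> [|i]; [apply: idealM|rewrite mderivM; apply: idealD;
    [apply: idealM|apply: idealMr]].
split=> [|i]; first exact/idealM/(diff_power_sub Jp).
rewrite mderivM; apply: (idealD (i := diff_power N.+1)); first exact: idealM.
by apply: IHN => //; case: Jp => _; apply.
Qed.

Hypothesis char0 : forall k, k.+1%:R != 0 :> K.

Section Retraction.
Variables (m : nat) (f : 'I_m -> {mpoly K[n]}).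
Hypothesis If : forall p, I p <-> ideal_span f p.
Variables (E : 'I_n -> 'I_n -> {mpoly K[n]}) (c : 'I_n -> 'I_m -> {mpoly K[n]}).
Hypothesis E_split : forall i j,
  I ((i == j)%:R - E i j - \sum_l c i l * (f l)^`M(j)).
Hypothesis E_deriv : forall l j, I (\sum_i (f l)^`M(i) * E i j).

(** Modulo I, the matrix E is a projector onto the vector fields tangent to the zero scheme of I,
    and [D j] is the tangential component of the partial derivative j. The coefficients [y] vanish
    on that scheme and have the complementary projector as Jacobian, so Y behaves like an Euler
    field in the normal directions. *)
Let D j p := \sum_i E i j * p^`M(i).
Let y i := \sum_l c i l * f l.
Definition retraction_deriv p := \sum_i y i * p^`M(i).
Local Notation Y := retraction_deriv.

Let Iy i : I (y i).
Proof. by apply/If; exists (c i). Qed.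

Let DD j p q : D j (p + q) = D j p + D j q.
Proof.
by rewrite -big_split; apply: eq_bigr => i _ /=; rewrite mderivD mulrDr.
Qed.

Let DM j p q : D j (p * q) = D j p * q + p * D j q.
Proof.
rewrite mulr_suml mulr_sumr -big_split; apply: eq_bigr => i _ /=.
by rewrite mderivM mulrDr mulrA [p * (_ * _)]mulrCA !mulrA.
Qed.

Let ID j p : I p -> I (D j p).
Proof.
move=> /If[a ->]; elim/big_rec: _ => [|l q _ Iq].
  by rewrite /D big1 => [|i _]; rewrite ?mderiv0 ?mulr0 //; apply: ideal0.
rewrite DD DM; apply: idealD => //; apply: idealD.
  by apply: idealM; apply/If/ideal_span_gen.
apply: idealM; rewrite /D (eq_bigr (fun i => (f l)^`M(i) * E i j)) // => i _.
exact: mulrC.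
Qed.

(** A tangential derivation costs no order: it preserves I, and its commutator with a partial
    derivative is again a combination of partial derivatives. *)
Let JD N j p : diff_power N p -> diff_power N (D j p).
Proof.
elim: N p => [|N IHN] p; first exact: ID.
move=> [Ip Jp]; split=> [|i]; first exact: ID.
change (diff_power N (D j p)^`M(i)).
have -> : (D j p)^`M(i) = D j p^`M(i) + \sum_k (E k j)^`M(i) * p^`M(k).
  rewrite /D raddf_sum -big_split; apply: eq_bigr => k _ /=.
  by rewrite mderivM addrC mderiv_comm.
apply: (idealD (i := diff_power N)); first exact/IHN/Jp.
by apply: ideal_sum => k _; apply: idealM; apply: Jp.
Qed.

Let y_deriv i k : I ((y k)^`M(i) - ((k == i)%:R - E k i)).
Proof.
apply: (@ideal_trans _ I (\sum_l c k l * (f l)^`M(i))).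
  rewrite /y raddf_sum -sumrB; apply: ideal_sum => l _ /=.
  by rewrite mderivM addrK; apply: idealM; apply/If/ideal_span_gen.
by apply: ideal_sym.
Qed.

Let deriv_retraction i p : (Y p)^`M(i) = Y p^`M(i) + p^`M(i) - D i p +
  \sum_k ((y k)^`M(i) - ((k == i)%:R - E k i)) * p^`M(k).
Proof.
have {2}-> : p^`M(i) = \sum_k (k == i)%:R * p^`M(k).
  rewrite (bigD1 i) //= eqxx mul1r big1 ?addr0 // => k /negbTE->.
  by rewrite mul0r.
rewrite raddf_sum -!big_split -sumrB -big_split; apply: eq_bigr => k _ /=.
by rewrite mderivM mderiv_comm; ring.
Qed.

(* Up to higher order, [diff_power N] is the power [N.+1] of [I] in the normal
   directions, on which [Y] acts as multiplication by [N.+1]. *)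
Lemma retraction_diff_power N p : diff_power N p ->
  diff_power N.+1 (p *+ N.+1 - Y p).
Proof.
have IY q : I (Y q) by apply: ideal_sum => i _; apply: idealMr.
elim: N p => [|N IHN] p Jp; split=> [|i].
- by apply: idealB.
- rewrite mulr1n mderivB deriv_retraction.
  set r := \sum_k _; have -> : p^`M(i) - (Y p^`M(i) + p^`M(i) - D i p + r) =
    D i p - (Y p^`M(i) + r) by ring.
  apply: idealB; first exact: ID.
  by apply: idealD => //; apply: ideal_sum => k _; apply/idealMr/y_deriv.
- by apply: idealB => //; rewrite -mulr_natr; apply/idealMr/(diff_power_sub Jp).
- change (diff_power N.+1 (p *+ N.+2 - Y p)^`M(i)).
  rewrite mderivB mderivMn deriv_retraction.
  set r := \sum_k _; have -> : p^`M(i) *+ N.+2 - (Y p^`M(i) + p^`M(i) - D i p + r) =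
    (p^`M(i) *+ N.+1 - Y p^`M(i)) + (D i p - r) by rewrite [_ *+ N.+2]mulrS; ring.
  have [_ Jp'] := Jp.
  apply: (idealD (i := diff_power N.+1)); first exact/IHN/Jp'.
  apply: (idealB (D := diff_power N.+1)); first exact: JD.
  apply: (ideal_sum (D := diff_power N.+1)) => k _.
  by apply: diff_powerM; [apply: y_deriv|apply: Jp'].
Qed.

Local Notation I2 := (ideal_prod I I).

(** Each correction Yq / (N + 2) is in the square of I, because both [y i] and the first derivatives
    of q lie in I; it moves the remainder up one level. Starting at level 1 ensures that those
    derivatives are in I. *)
Lemma diff_power_approx p : diff_power 1 p ->
  forall N, exists2 g, I2 g & diff_power N (p - g).
Proof.
move=> Jp; case=> [|N].
  by exists 0; [apply: ideal0|rewrite subr0; case: Jp].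
elim: N => [|N [g I2g Jg]]; first by exists 0; [apply: ideal0|rewrite subr0].
set q := p - g in Jg; exists (g + N.+2%:R^-1 *: Y q).
  apply: idealD => //; rewrite -mul_mpolyC; apply: idealM.
  apply: ideal_sum => i _; apply: ideal_prod_gen => //.
  by case: Jg => _ Jg; apply: diff_power_sub (Jg i).
have -> : p - (g + N.+2%:R^-1 *: Y q) =
    (N.+2%:R^-1)%:MP * (q *+ N.+2 - Y q).
  rewrite mulrBr !mul_mpolyC -scaler_nat scalerA mulVf // scale1r.
  by rewrite opprD addrA.
by apply: idealM; apply: retraction_diff_power.
Qed.

End Retraction.
End DifferentialPowers.

Section DiagonalKrull.
Variables (K : fieldType) (n : nat) (I : ideal {mpoly K[n]}).
Hypothesis char0 : forall k, k.+1%:R != 0 :> K.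
Local Notation P := {mpoly K[n]}.
Local Notation T := {mpoly P[n]}.

(** Taylor expansion p(x + z). Here the indeterminates of T are increments z; [shift_gap]
    substitutes x' for x and x - x' for z, which gives back p(x). *)
Definition shift : {rmorphism P -> T} :=
  meval_at (mpolyC n (R := P) \o mpolyC n (R := K)) (fun i => ('X_i)%:MP + 'X_i).

Definition gap (i : 'I_n) : T := ('X_i)%:MP - 'X_i.

Lemma shift_deriv i p : (shift p)^`M(i) = shift p^`M(i).
Proof.
have wE j : (('X_j)%:MP + 'X_j : T)^`M(i) = (j == i)%:R.
  by rewrite mderivD mderivC add0r mderivXU.
rewrite (chain_rule (theta := idfun) (d := mderiv i)) => [|a b|c]; last 1 first.
- exact: mderivC.
- rewrite (bigD1 i) //= big1 => [|j /negbTE ji].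
    by rewrite addr0 wE eqxx mulr1n; exact: mulr1.
  by rewrite wE ji; exact: mulr0.
- exact: mderivM.
Qed.

Lemma shift_coef0 p : (shift p)@_0%MM = p.
Proof.
apply: (mpoly_morph_ext (g := mcoeff 0%MM \o shift) (h := idfun)) => [c|i] /=.
  by rewrite meval_atC mpolyCK.
by rewrite meval_atX mcoeffD mcoeffC eqxx mulr1 mcoeffX mnm1_eq0 addr0.
Qed.

(** Taylor coefficients are derivatives divided by factorials, so characteristic 0 enters here, one
    factor at a time. *)
Lemma shift_coef N p m : diff_power I N p -> (mdeg m <= N)%N -> I (shift p)@_m.
Proof.
elim: N p m => [|N IHN] p m Jp lt_mN.
  by move: lt_mN; rewrite leqn0 mdeg_eq0 => /eqP->; rewrite shift_coef0.
have [->|/eqP] := eqVneq m 0%MM; first by rewrite shift_coef0; case: Jp.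
move/mnmP => m0; have [i mi] : exists i, m i != 0%N.
  by apply: contrapT => m00; apply: m0 => i; rewrite mnm0E; apply/eqP;
    apply: contra_notT m00; exists i.
have m_eq : m = ((m - U_(i)) + U_(i))%MM by rewrite submK // lep1mP.
have := IHN p^`M(i) (m - U_(i))%MM; rewrite -shift_deriv mcoeff_mderiv -m_eq.
case: Jp => _ Jp /(_ (Jp i)); move: lt_mN; rewrite {1}m_eq mdegD mdeg1 addn1.
move=> lt_mN /(_ lt_mN); set d := ((m - U_(i))%MM i) => Im.
have -> : (shift p)@_m = (d.+1%:R^-1)%:MP * ((shift p)@_m *+ d.+1).
  by rewrite mul_mpolyC -scaler_nat scalerA mulVf // scale1r.
exact: idealM.
Qed.

Lemma shift_gap p : meval_at second gap (shift p) = p%:MP.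
Proof.
apply: (mpoly_morph_ext (g := meval_at second gap \o shift)
  (h := mpolyC n (R := P))) => [c|i] /=.
  by rewrite meval_atC meval_atC secondC.
by rewrite meval_atX rmorphD /= meval_atC meval_atX secondX addrC subrK.
Qed.

(** In the Taylor expansion of p(x) about x', the terms of degree at most nk have coefficients in
    the second copy of I. In a term of larger degree one of the n exponents is at least k, by the
    pigeonhole principle. *)
Lemma diff_power_gap k p : diff_power I (n * k) p ->
  ideal_sum2 (second_ideal I) (ideal_span (fun i => gap i ^+ k)) p%:MP.
Proof.
move=> Jp; rewrite -shift_gap; apply: ideal_sum => m _.
have [le_mk|lt_km] := leqP (mdeg m) (n * k).
  exists (second (shift p)@_m * \prod_i gap i ^+ m i); last first.
    by rewrite subrr; apply: ideal0.
  apply: idealMr; apply: generated_gen; exists (shift p)@_m => //.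
  exact: shift_coef le_mk.
exists 0; first exact: ideal0.
rewrite subr0; apply: idealM.
have [i lt_ki] : exists i, (k <= m i)%N.
  apply: contrapT => small; move: lt_km; rewrite ltnNge => /negP; apply.
  rewrite mdegE -[n in (n * k)%N]card_ord -sum_nat_const; apply: leq_sum => i _.
  by rewrite leqNgt; apply/negP => /ltnW lt_km; apply: small; exists i.
rewrite (bigD1 i) //; apply: idealMr; rewrite -(subnK lt_ki) exprD.
by apply: idealM; apply: (ideal_span_gen (fun i => gap i ^+ k)).
Qed.

(** Krull's theorem is applied in two copies of the variables, modulo I in the second and D in the
    first, to the ideal of the diagonal. Its factor 1 - a restricts to 1 on the diagonal, so
    [diagonal_descent] removes it. *)
Lemma diff_power_intersection (D : ideal P) p :
  (forall q, I q -> D (q * p)) ->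
  (forall N, exists2 g, D g & diff_power I N (p - g)) -> D p.
Proof.
move=> DI Dapprox.
have noethT : noetherian T.
  by apply/noetherian_mpoly/noetherian_mpoly/noetherian_field.
pose B := ideal_sum2 (second_ideal I) (coef_ideal n D).
have [|a gap_a Ba] := @krull_intersection _ _ gap B p%:MP noethT.
  move=> k; have [g Dg /diff_power_gap[b Ib gap_b]] := Dapprox (n * k)%N.
  exists (b + g%:MP).
    exists b => //; rewrite addrC addKr => m; rewrite mcoeffC.
    exact: idealMr.
  by rewrite opprD addrA addrAC -mpolyCB.
apply: diagonal_descent DI _ Ba.
rewrite rmorphB rmorph1 subKr; have -> : diag a = 0; last exact: ideal0.
case: gap_a => c ->; rewrite raddf_sum big1 // => i _.
apply: (etrans (rmorphM diag _ _)).
by rewrite (rmorphB diag) diagC diagX subrr mulr0.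
Qed.

Theorem retraction_mod_square (m : nat) (f : 'I_m -> P)
    (E : 'I_n -> 'I_n -> P) (c : 'I_n -> 'I_m -> P) :
  (forall p, I p <-> ideal_span f p) ->
  (forall i j, I ((i == j)%:R - E i j - \sum_l c i l * (f l)^`M(j))) ->
  (forall l j, I (\sum_i (f l)^`M(i) * E i j)) ->
  forall p, I p -> ideal_prod I I (p - retraction_deriv f c p).
Proof.
move=> If E_split E_deriv p Ip.
have Jp : diff_power I 1 (p - retraction_deriv f c p).
  exact: (retraction_diff_power If E_split E_deriv (N := 0)).
apply: diff_power_intersection => [q Iq|].
  by apply: ideal_prod_gen => //; case: Jp.
exact: (diff_power_approx char0 If E_split E_deriv).
Qed.

End DiagonalKrull.

(** * The Jacobian criterion *)

Definition zero_of (R : comNzRingType) n m (f : 'I_m -> {mpoly R[n]})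
    (Q : algebra R) (q : 'I_n -> Q) : Prop :=
  forall l, meval_at (structure_map Q) q (f l) = 0.

Lemma zero_of_span (R : comNzRingType) n m (f : 'I_m -> {mpoly R[n]})
    (Q : algebra R) (q : 'I_n -> Q) p :
  zero_of f q -> ideal_span f p -> meval_at (structure_map Q) q p = 0.
Proof.
move=> fq [c ->]; rewrite raddf_sum big1 // => l _.
by apply: (etrans (rmorphM _ _ _)); rewrite /= fq mulr0.
Qed.

Section QuotientAlgebra.
Variables (R : comNzRingType) (n m : nat) (f : 'I_m -> {mpoly R[n]}).
Local Notation I := (ideal_span f).

Definition quotient_algebra : algebra R :=
  Algebra (to_quo I \o mpolyC n (R := R)).

Definition quotient_hom : algebra_hom (mpoly_algebra R n) quotient_algebra :=
  @AlgebraHom R (mpoly_algebra R n) quotient_algebra (to_quo I) (fun=> erefl).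

Definition coordinate (i : 'I_n) : quotient_algebra := to_quo I 'X_i.

Lemma quotient_algebra_fp : finitely_presented quotient_algebra.
Proof.
exists n, quotient_hom; split; first exact: to_quo_surj.
by exists m, f => p; apply: to_quo_eq0.
Qed.

Lemma quotient_hom_eval (Q : algebra R) (h : algebra_hom quotient_algebra Q) p :
  h (to_quo I p) = meval_at (structure_map Q) (h \o coordinate) p.
Proof.
apply: (mpoly_morph_ext (g := h \o to_quo I)) => [c|i] /=.
  by rewrite meval_atC -(hom_structure h).
by rewrite meval_atX.
Qed.

Lemma quotient_hom_zero (Q : algebra R) (h : algebra_hom quotient_algebra Q) :
  zero_of f (h \o coordinate).
Proof.
move=> l; rewrite -quotient_hom_eval.
have /to_quo_eq0 -> : I (f l) by apply: ideal_span_gen.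
exact: rmorph0.
Qed.

Section PointHom.
Variables (Q : algebra R) (q : 'I_n -> Q).
Hypothesis fq : zero_of f q.

Let kill p : I p -> meval_at (structure_map Q) q p = 0.
Proof. exact: zero_of_span. Qed.

Definition point_rmorphism : {rmorphism quotient_algebra -> Q} :=
  quo_lift kill.

Lemma point_structure r :
  point_rmorphism (structure_map quotient_algebra r) = structure_map Q r.
Proof. exact: (etrans (quo_liftE kill _) (meval_atC _ _ _)). Qed.

Definition point_hom : algebra_hom quotient_algebra Q :=
  AlgebraHom point_structure.

Lemma point_hom_coordinate i : point_hom (coordinate i) = q i.
Proof. exact: (etrans (quo_liftE kill _) (meval_atX _ _ _)). Qed.

End PointHom.

Lemma quotient_hom_ext (Q : algebra R) (g h : algebra_hom quotient_algebra Q) :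
  (forall i, g (coordinate i) = h (coordinate i)) -> g = h.
Proof.
move=> gh; apply: algebra_hom_ext => x; have [p <-] := to_quo_surj x.
by rewrite !quotient_hom_eval; apply: eq_meval_at.
Qed.

(* The Jacobian criterion: the entries of [h] define the vector fields that
   split the conormal sequence of [I]. *)
Definition smooth_certificate : Prop :=
  exists h : 'I_n -> 'I_m -> {mpoly R[n]}, forall j,
  exists c : 'I_m -> 'I_m -> {mpoly R[n]},
    f j = \sum_i (\sum_l h i l * f l) * (f j)^`M(i) +
          \sum_a \sum_b c a b * f a * f b.

Lemma meval_at_taylor (B : comPzRingType) (phi : {rmorphism R -> B})
    (b nu : 'I_n -> B) p : (forall i j, nu i * nu j = 0) ->
  meval_at phi (fun i => b i - nu i) p =
  meval_at phi b p - \sum_i meval_at phi b p^`M(i) * nu i.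
Proof.
move=> nu2; elim/mpoly_ring_ind: p => [c|j|p q IHp IHq|p q IHp IHq].
- rewrite !meval_atC big1 ?subr0 // => i _.
  by rewrite mderivC raddf0 mul0r.
- rewrite !meval_atX; congr (_ - _).
  rewrite (bigD1 j) //= mderivXU eqxx rmorph1 mul1r big1 ?addr0 // => i.
  by rewrite mderivXU eq_sym => /negbTE->; rewrite rmorph0 mul0r.
- rewrite !raddfD /= IHp IHq addrACA -opprD -big_split; congr (_ - _).
  by apply: eq_bigr => i _ /=; rewrite !raddfD mulrDl.
- rewrite !rmorphM /= IHp IHq; set x := \sum_i _; set y := \sum_i _.
  have xy : x * y = 0.
    rewrite mulr_suml big1 // => i _; rewrite mulr_sumr big1 // => j _.
    by rewrite mulrACA nu2 mulr0.
  rewrite mulrBl !mulrBr xy subr0 -addrA -opprD; congr (_ - _).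
  rewrite mulr_sumr mulr_suml -big_split; apply: eq_bigr => i _ /=.
  by rewrite mderivM rmorphD !rmorphM /= mulrDl addrC mulrA mulrAC.
Qed.

(** One Newton step. An arbitrary lift b of the coordinates is corrected by the vector [nu], built
    from [h] and f(b). The values f(b) lie in the square-zero kernel, so the Taylor formula stops at
    first order and the quadratic part of the certificate vanishes. *)
Lemma certificate_formally_smooth :
  smooth_certificate -> formally_smooth quotient_algebra.
Proof.
move=> [h hc] B C q surj sq u.
have [b bP] := choice (fun i => surj (u (coordinate i))).
pose phi := structure_map B.
have q_eval p : q (meval_at phi b p) = u (to_quo I p).
  rewrite quotient_hom_eval meval_at_morph; apply: eq_meval_at => // r /=.
  exact: hom_structure.
have qf l : q (meval_at phi b (f l)) = 0.
  by rewrite q_eval quotient_hom_eval quotient_hom_zero.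
pose nu i := \sum_l meval_at phi b (h i l) * meval_at phi b (f l).
have qnu i : q (nu i) = 0.
  by rewrite rmorph_sum big1 // => l _; rewrite rmorphM qf mulr0.
have b'f : zero_of f (fun i => b i - nu i).
  move=> j; rewrite meval_at_taylor => [|i i']; last by apply: sq.
  have [c fj] := hc j; rewrite {1}fj !(rmorphD, rmorph_sum) /=.
  rewrite [X in _ + X - _]big1 => [|a _]; last first.
    rewrite rmorph_sum big1 // => a' _.
    by rewrite !rmorphM /= -mulrA (sq _ _ (qf a) (qf a')) mulr0.
  rewrite addr0 -sumrB big1 // => i _.
  rewrite rmorphM rmorph_sum /nu /=.
  under eq_bigr => l _ do rewrite rmorphM.
  by rewrite mulrC subrr.
exists (point_hom b'f); apply: quotient_hom_ext => i.
apply: (etrans (congr1 q (point_hom_coordinate b'f i))).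
by rewrite rmorphB qnu subr0 bP.
Qed.

Lemma certificate_smooth : smooth_certificate -> smooth_algebra quotient_algebra.
Proof.
by split; [apply: quotient_algebra_fp|apply: certificate_formally_smooth].
Qed.

End QuotientAlgebra.

Lemma retraction_certificate (K : fieldType) n m (f : 'I_m -> {mpoly K[n]})
    (E : 'I_n -> 'I_n -> {mpoly K[n]}) (c : 'I_n -> 'I_m -> {mpoly K[n]}) :
  (forall k, k.+1%:R != 0 :> K) ->
  (forall i j,
    ideal_span f ((i == j)%:R - E i j - \sum_l c i l * (f l)^`M(j))) ->
  (forall l j, ideal_span f (\sum_i (f l)^`M(i) * E i j)) ->
  smooth_certificate f.
Proof.
move=> char0 E_split E_deriv; exists c => j.
have := @retraction_mod_square K n (ideal_span f) char0 m f E c (fun=> iff_refl _)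
  E_split E_deriv (f j) (ideal_span_gen f j).
move=> /ideal_span_prodP[d fj]; exists d.
by rewrite -fj addrC subrK.
Qed.

(** * Cartier's theorem *)

Section GroupFunctorTheory.
Variables (R : comPzRingType) (G : group_functor R).

Lemma gmap1 Q Q' (f : algebra_hom Q Q') : gmap f (1 : G Q)%g = 1%g.
Proof. by apply: (mulgI (gmap f 1%g)); rewrite -gmapM !mulg1. Qed.

Lemma gmapV Q Q' (f : algebra_hom Q Q') (g : G Q) : gmap f g^-1%g = (gmap f g)^-1%g.
Proof. by apply: (mulgI (gmap f g)); rewrite -gmapM !mulgV gmap1. Qed.

End GroupFunctorTheory.

(* [co] are affine coordinates on [G] in which [S] has equations [f]; [G] itself
   need not be affine beyond [S]. *)
Record chart (R : comNzRingType) (G : group_functor R) (S : forall Q, G Q -> Prop)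
    n m (f : 'I_m -> {mpoly R[n]}) (co : forall Q : algebra R, G Q -> 'I_n -> Q) :
    Prop := Chart {
  chart_natural : forall Q Q' (h : algebra_hom Q Q') g i,
    co Q' (gmap h g) i = h (co Q g i);
  chart_inj : forall Q g g', co Q g =1 co Q g' -> g = g';
  chart_zero : forall Q g, S Q g <-> zero_of f (co Q g);
  chart_surj : forall (Q : algebra R) (q : 'I_n -> Q), zero_of f q -> exists g, co Q g =1 q }.

Lemma zero_of_ext (R : comNzRingType) n m (f : 'I_m -> {mpoly R[n]})
    (Q : algebra R) (q q' : 'I_n -> Q) : q =1 q' -> zero_of f q -> zero_of f q'.
Proof. by move=> qq' fq l; rewrite -(fq l); apply: eq_meval_at. Qed.

Lemma zero_of_hom (R : comNzRingType) n m (f : 'I_m -> {mpoly R[n]})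
    (Q Q' : algebra R) (h : algebra_hom Q Q') (q : 'I_n -> Q) :
  zero_of f q -> zero_of f (h \o q).
Proof.
move=> fq l; rewrite -[RHS](rmorph0 h) -(fq l) meval_at_morph.
by apply: eq_meval_at => // c; rewrite -(hom_structure h).
Qed.

Lemma chart_sub_natural (R : comNzRingType) (G : group_functor R)
    (S : forall Q, G Q -> Prop) n m (f : 'I_m -> {mpoly R[n]})
    (co : forall Q : algebra R, G Q -> 'I_n -> Q) :
  chart S f co -> forall Q Q' (h : algebra_hom Q Q') g, S Q g -> S Q' (gmap h g).
Proof.
move=> chartS Q Q' h g /(chart_zero chartS) fg; apply/(chart_zero chartS).
apply: zero_of_ext (zero_of_hom h fg) => i.
by rewrite (chart_natural chartS).
Qed.

Lemma chart_represented (R : comNzRingType) (G : group_functor R)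
    (S : forall Q, G Q -> Prop) n m (f : 'I_m -> {mpoly R[n]})
    (co : forall Q : algebra R, G Q -> 'I_n -> Q) :
  chart S f co -> represented_by S (quotient_algebra f).
Proof.
case=> conat coinj coS cosurj.
have ex Q (h : algebra_hom (quotient_algebra f) Q) :
    exists g, co Q g =1 h \o coordinate f by apply/cosurj/quotient_hom_zero.
pose ev Q h : G Q := projT1 (cid (ex Q h)).
have evP Q h i : co Q (ev Q h) i = h (coordinate f i) by apply: projT2 (cid (ex Q h)) i.
exists ev; split=> [Q Q' h u|Q u v uv|Q g].
- by apply: coinj => i; rewrite conat !evP.
- by apply: quotient_hom_ext => i; rewrite -!evP uv.
- split=> [/coS fg|[h <-]].
    exists (point_hom fg); apply: coinj => i.
    by rewrite evP; apply: point_hom_coordinate.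
  apply/coS; apply: zero_of_ext (quotient_hom_zero h) => i.
  by rewrite evP.
Qed.

Lemma meval_at_congr n (R : comNzRingType) (S : comPzRingType) (D : ideal S)
    (phi : {rmorphism R -> S}) (a b : 'I_n -> S) p :
  (forall i, D (a i - b i)) -> D (meval_at phi a p - meval_at phi b p).
Proof.
move=> ab; apply/to_quoE; rewrite !meval_at_morph; apply: eq_meval_at => // i /=.
exact/to_quoE.
Qed.

Lemma meval_at_id n (R : comNzRingType) (p : {mpoly R[n]}) :
  meval_at (mpolyC n (R := R)) (fun i => 'X_i) p = p.
Proof.
apply: (mpoly_morph_ext (g := meval_at (mpolyC n (R := R)) (fun i => 'X_i))
  (h := idfun)) => [c|i]; first exact: meval_atC.
exact: meval_atX.
Qed.

Section DualNumbers.
Variables (K : fieldType) (n : nat).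
Local Notation P := {mpoly K[n]}.
Local Notation T := {mpoly P[n]}.
Variables (m : nat) (f : 'I_m -> P).
Local Notation I := (ideal_span f).

(* A polynomial in a second set of variables z is only considered modulo the
   square of the ideal (z): it is given by its constant and linear parts. *)
Definition constant_part : {rmorphism T -> P} := mcoeff 0%MM.

Definition linear_part (j : 'I_n) : {additive T -> P} := mcoeff 0%MM \o mderiv j.

Lemma constant_partE t : constant_part t = t@_0%MM.
Proof. by []. Qed.

Lemma linear_partE j t : linear_part j t = constant_part t^`M(j).
Proof. by []. Qed.

Lemma linear_partM j s t : linear_part j (s * t) =
  linear_part j s * constant_part t + constant_part s * linear_part j t.
Proof.
rewrite /linear_part /= mderivM raddfD.
by congr (_ + _); apply: (rmorphM constant_part).
Qed.

Lemma constant_partC p : constant_part p%:MP = p.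
Proof. exact: mpolyCK. Qed.

Lemma linear_partC j p : linear_part j p%:MP = 0.
Proof. by rewrite /linear_part /= mderivC mcoeff0. Qed.

Lemma constant_partX i : constant_part 'X_i = 0.
Proof. by rewrite /constant_part /= mcoeffX mnm1_eq0. Qed.

Lemma linear_partX j i : linear_part j 'X_i = (i == j)%:R.
Proof. by rewrite /linear_part /= mderivXU; apply: (rmorph_nat constant_part). Qed.

Lemma constant_partZ p t : constant_part (p *: t) = p * constant_part t.
Proof. by rewrite -mul_mpolyC rmorphM constant_partC. Qed.

Lemma linear_partZ j p t : linear_part j (p *: t) = p * linear_part j t.
Proof.
by rewrite -mul_mpolyC linear_partM linear_partC constant_partC mul0r add0r.
Qed.

Definition const2 : {rmorphism K -> T} := mpolyC n (R := P) \o mpolyC n (R := K).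

Lemma constant_part_eval (w : 'I_n -> T) p :
  constant_part (meval_at const2 w p) =
  meval_at (mpolyC n (R := K)) (constant_part \o w) p.
Proof. by rewrite meval_at_morph; apply: eq_meval_at => // c /=; apply: mpolyCK. Qed.

Lemma linear_part_eval j (w : 'I_n -> T) p :
  linear_part j (meval_at const2 w p) =
  \sum_i constant_part (meval_at const2 w p^`M(i)) * linear_part j (w i).
Proof.
apply: chain_rule; first exact: linear_partM.
by move=> c; apply: linear_partC.
Qed.

Definition dual_ideal : ideal T.
Proof.
apply: (@Ideal T (fun t => I (constant_part t) /\ forall j, I (linear_part j t))).
- by rewrite rmorph0; split=> [|j]; rewrite ?raddf0; apply: ideal0.
- move=> s t [Is Ds] [It Dt]; rewrite rmorphD.
  by split=> [|j]; rewrite ?raddfD; apply: idealD.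
- move=> s t [It Dt]; rewrite rmorphM; split=> [|j]; first exact: idealM.
  by rewrite linear_partM; apply: idealD; apply: idealM.
Defined.

(* The linear part is taken in the module of differentials of [P / I]. *)
Definition differential_ideal : ideal T.
Proof.
apply: (@Ideal T (fun t => I (constant_part t) /\ exists c : 'I_m -> P,
  forall j, I (linear_part j t - \sum_l c l * (f l)^`M(j)))).
- rewrite rmorph0; split; first exact: ideal0.
  exists (fun=> 0) => j; rewrite raddf0 sub0r big1 ?oppr0 => [|l _].
    exact: ideal0.
  exact: mul0r.
- move=> s t [Is [c Dc]] [It [d Dd]]; rewrite rmorphD; split; first exact: idealD.
  exists (fun l => c l + d l) => j.
  have -> : \sum_l (c l + d l) * (f l)^`M(j) =
      \sum_l c l * (f l)^`M(j) + \sum_l d l * (f l)^`M(j).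
    by rewrite -big_split; apply: eq_bigr => l _; rewrite mulrDl.
  by rewrite raddfD opprD addrACA; apply: idealD.
- move=> s t [It [c Dc]]; rewrite rmorphM; split; first exact: idealM.
  exists (fun l => constant_part s * c l) => j; rewrite linear_partM.
  under eq_bigr => l _ do rewrite -mulrA.
  rewrite -mulr_sumr -addrA -mulrBr; apply: idealD; last exact: idealM.
  exact: idealM.
Defined.

Definition constant_ideal : ideal T := ideal_preim constant_part I.

(** With A = P / I, the ideals [dual_ideal], [differential_ideal] and [constant_ideal] give A + A^n,
    A + Omega_A and A: dual numbers in n directions, the target of the universal derivation x + dx,
    and A itself. *)
Definition quotient2 (D : ideal T) : algebra K := Algebra (to_quo D \o const2).

Section Projection.
Variables D D' : ideal T.
Hypothesis DD' : forall t, D t -> D' t.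

Let kill t : D t -> to_quo D' t = 0.
Proof. by move=> /DD' /to_quo_eq0. Qed.

Definition projection2 : algebra_hom (quotient2 D) (quotient2 D') :=
  @AlgebraHom K (quotient2 D) (quotient2 D') (quo_lift kill)
    (fun c => quo_liftE kill _).

Lemma projection2E t : projection2 (to_quo D t) = to_quo D' t.
Proof. exact: (quo_liftE kill). Qed.

End Projection.

Definition point2 (D : ideal T) (w : 'I_n -> T) (i : 'I_n) : quotient2 D :=
  to_quo D (w i).

Lemma zero_of_point2 D w :
  zero_of f (point2 D w) <-> forall l, D (meval_at const2 w (f l)).
Proof.
have e l : meval_at (structure_map (quotient2 D)) (point2 D w) (f l) =
    to_quo D (meval_at const2 w (f l)) by rewrite meval_at_morph.
by split=> fw l; [apply/to_quo_eq0; rewrite -e|rewrite e; apply/to_quo_eq0].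
Qed.

Lemma dual_differential t : dual_ideal t -> differential_ideal t.
Proof.
case=> It Dt; split=> //; exists (fun=> 0) => j.
by rewrite big1 ?subr0 // => l _; rewrite mul0r.
Qed.

Lemma differential_constant t : differential_ideal t -> constant_ideal t.
Proof. by case. Qed.

End DualNumbers.

Definition base_algebra (R : comPzRingType) : algebra R :=
  @Algebra R R idfun.

Definition base_hom (R : comPzRingType) (Q : algebra R) :
    algebra_hom (base_algebra R) Q :=
  @AlgebraHom R (base_algebra R) Q (structure_map Q) (fun=> erefl).

Section Cartier.
Variables (K : fieldType) (n m : nat) (G : group_functor K).
Variables (S : forall Q, G Q -> Prop) (f : 'I_m -> {mpoly K[n]}).
Variable co : forall Q : algebra K, G Q -> 'I_n -> Q.
Hypothesis chartS : chart S f co.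
Hypothesis S1 : forall Q, S (1%g : G Q).
Hypothesis SM : forall Q (g h : G Q), S g -> S h -> S (g * h)%g.
Hypothesis SV : forall Q (g : G Q), S g -> S g^-1%g.
Local Notation P := {mpoly K[n]}.
Local Notation T := {mpoly P[n]}.
Local Notation I := (ideal_span f).
Local Notation const2 := (const2 K n).
Local Notation constant_part := (@constant_part K n).
Local Notation linear_part := (@linear_part K n).

Let to_diff := projection2 (@dual_differential K n m f).
Let to_const := projection2 (@differential_constant K n m f).

Let to_diffE t : to_diff (to_quo _ t) = to_quo (differential_ideal f) t.
Proof. exact: projection2E. Qed.

Let to_constE t : to_const (to_quo _ t) = to_quo (constant_ideal f) t.
Proof. exact: projection2E. Qed.

Definition unit_coord (i : 'I_n) : K := co (1%g : G (base_algebra K)) i.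

Lemma co_unit (Q : algebra K) i : co (1%g : G Q) i = structure_map Q (unit_coord i).
Proof. by rewrite -(gmap1 G (base_hom Q)) (chart_natural chartS). Qed.

Lemma unit_zero l : meval_at idfun unit_coord (f l) = 0.
Proof. by have /(chart_zero chartS)/(_ l) := @S1 (base_algebra K). Qed.

Definition jacobian_at_unit : 'M[K]_(m, n) :=
  \matrix_(l, i) meval_at idfun unit_coord (f l)^`M(i).
Local Notation M := jacobian_at_unit.

(** The tautological A-point of S, for A = P / I, seen in the dual numbers. *)
Lemma generic_point : exists2 g : G (quotient2 (dual_ideal f)),
  S g & co g =1 point2 (dual_ideal f) (fun i => ('X_i)%:MP).
Proof.
have zero : zero_of f (point2 (dual_ideal f) (fun i => ('X_i)%:MP)).
  apply/zero_of_point2 => l; split=> [|j].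
    rewrite constant_part_eval; have -> : meval_at (mpolyC n (R := K))
        (constant_part \o (fun i => ('X_i)%:MP)) (f l) = f l.
      by rewrite -[RHS]meval_at_id; apply: eq_meval_at => // i; apply: constant_partC.
    exact: ideal_span_gen.
  rewrite linear_part_eval big1 => [|i _]; first exact: ideal0.
  by rewrite linear_partC mulr0.
have [g gP] := chart_surj chartS zero; exists g => //.
by apply/(chart_zero chartS); apply: zero_of_ext zero => i; rewrite gP.
Qed.

(** The point x + dx satisfies the equations because df = 0 in the module of differentials. *)
Lemma shifted_point : exists2 g : G (quotient2 (differential_ideal f)),
  S g & co g =1 point2 (differential_ideal f) (fun i => ('X_i)%:MP + 'X_i).
Proof.
have zero : zero_of f (point2 (differential_ideal f) (fun i => ('X_i)%:MP + 'X_i)).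
  apply/zero_of_point2 => l; rewrite -/(shift K n (f l)).
  split; first by rewrite constant_partE shift_coef0; apply: ideal_span_gen.
  exists (fun l' => (l' == l)%:R) => j.
  have -> : \sum_l' (l' == l)%:R * (f l')^`M(j) = (f l)^`M(j).
    rewrite (bigD1 l) //= eqxx mul1r big1 ?addr0 // => l' /negbTE->.
    exact: mul0r.
  rewrite linear_partE shift_deriv constant_partE shift_coef0 subrr.
  exact: ideal0.
have [g gP] := chart_surj chartS zero; exists g => //.
by apply/(chart_zero chartS); apply: zero_of_ext zero => i; rewrite gP.
Qed.

(* The infinitesimal translation [t] with [u * t = shifted point] lives at the
   unit, where it is a solution of the linear system [M] over the field [K];
   hence it lifts from differentials to dual numbers, and so does [u * t]. *)
Lemma differential_splitting : exists (E : 'I_n -> 'I_n -> P) (c : 'I_n -> 'I_m -> P),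
  (forall i j, I ((i == j)%:R - E i j - \sum_l c i l * (f l)^`M(j))) /\
  (forall l j, I (\sum_i (f l)^`M(i) * E i j)).
Proof.
have [u Su uP] := generic_point; have [s Ss sP] := shifted_point.
pose t := ((gmap to_diff u)^-1 * s)%g.
have St : S t by apply: SM => //; apply/SV/(chart_sub_natural chartS).
have [v vP] := choice (fun i => to_quo_surj (co t i)).
have tv : co t =1 point2 (differential_ideal f) v by move=> i; rewrite -vP.
(* The generic and the shifted points agree when differentials are set to 0, so t reduces to the
   unit. *)
have v0 i : I (constant_part (v i) - (unit_coord i)%:MP).
  have t1 : gmap to_const t = 1%g.
    rewrite gmapM gmapV.
    suff -> : gmap to_const s = gmap to_const (gmap to_diff u) by rewrite mulVg.
    apply: (chart_inj chartS) => j; rewrite !(chart_natural chartS) uP sP.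
    rewrite /point2 to_diffE !to_constE; apply/to_quoE; rewrite addrAC subrr add0r.
    change (I (constant_part 'X_j)); rewrite constant_partX; exact: ideal0.
  have := chart_natural chartS to_const t i.
  rewrite t1 co_unit tv /point2 to_constE => /to_quoE /ideal_sym.
  change (I (constant_part (v i - const2 (unit_coord i))) ->
    I (constant_part (v i) - (unit_coord i)%:MP)).
  by rewrite rmorphB constant_partC.
pose nv i j := linear_part j (v i).
pose Mn l j := \sum_i (M l i)%:MP * nv i j.
have dS l := (zero_of_point2 _ _ _).1 (zero_of_ext tv ((chart_zero chartS t).1 St)) l.
have Mn_diff l : exists c : 'I_m -> P, forall j,
    I (Mn l j - \sum_l' c l' * (f l')^`M(j)).
  have [_ [c Dc]] := dS l; exists c => j; apply: (ideal_trans _ (Dc j)).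
  rewrite linear_part_eval; apply: ideal_eq_sum => i _; apply: ideal_eqM; last first.
    by rewrite subrr; apply: ideal0.
  apply: ideal_sym; rewrite constant_part_eval mxE.
  have -> : (meval_at idfun unit_coord (f l)^`M(i))%:MP =
      meval_at (mpolyC n (R := K)) (fun i => (unit_coord i)%:MP) (f l)^`M(i).
    exact: (meval_at_morph _ (mpolyC n (R := K))).
  by apply: meval_at_congr => i'; apply: v0.
have [d dP] := choice Mn_diff.
pose N := pinvmx M.
have MNM : M *m N *m M = M by apply: mulmxKpV.
(* Since MNM = M, the corrected linear part is killed by M exactly. In the module of differentials
   it is unchanged, because M times [nv] already vanishes there. *)
pose nv' i j := nv i j - \sum_l (N i l)%:MP * Mn l j.
have Mnv' l j : \sum_i (M l i)%:MP * nv' i j = 0.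
  rewrite (eq_bigr (fun i => (M l i)%:MP * nv i j -
    \sum_l' (M l i * N i l')%:MP * Mn l' j)); last first.
    move=> i _; rewrite /nv' mulrBr mulr_sumr; congr (_ - _).
    by apply: eq_bigr => l' _; rewrite mpolyCM mulrA.
  rewrite sumrB exchange_big /=.
  under [X in _ - X]eq_bigr => l' _.
    rewrite -mulr_suml -rmorph_sum /=.
    have -> : \sum_i M l i * N i l' = (M *m N) l l' by rewrite mxE.
    rewrite /Mn mulr_sumr.
    over.
  rewrite exchange_big /=.
  under [X in _ - X]eq_bigr => i _.
    under eq_bigr => l' _ do rewrite mulrA -mpolyCM.
    rewrite -mulr_suml -rmorph_sum /=.
    have -> : \sum_l' (M *m N) l l' * M l' i = M l i by rewrite -[in RHS]MNM [RHS]mxE.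
    over.
  by rewrite subrr.
pose v' i : T := ((unit_coord i)%:MP)%:MP + \sum_j nv' i j *: 'X_j.
have v'0 i : constant_part (v' i) = (unit_coord i)%:MP.
  rewrite rmorphD constant_partC rmorph_sum big1 ?addr0 // => j _.
  by rewrite constant_partZ constant_partX mulr0.
have v'1 i j : linear_part j (v' i) = nv' i j.
  rewrite raddfD linear_partC add0r raddf_sum.
  rewrite -[RHS](sum_delta j (nv' i)).
  by apply: eq_bigr => k _; rewrite linear_partZ linear_partX.
have zero' : zero_of f (point2 (dual_ideal f) v').
  have ev p : constant_part (meval_at const2 v' p) = (meval_at idfun unit_coord p)%:MP.
    rewrite constant_part_eval (meval_at_morph _ (mpolyC n (R := K))).
    by apply: eq_meval_at.
  apply/zero_of_point2 => l; split=> [|j].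
    by rewrite ev unit_zero; apply: ideal0.
  suff -> : linear_part j (meval_at const2 v' (f l)) = 0 by apply: ideal0.
  rewrite linear_part_eval -[RHS](Mnv' l j); apply: eq_bigr => i _.
  by rewrite ev v'1 mxE.
have [t' t'P] := chart_surj chartS zero'.
have St' : S t'.
  by apply/(chart_zero chartS); apply: zero_of_ext zero' => i; rewrite t'P.
have t't : gmap to_diff t' = t.
  apply: (chart_inj chartS) => i; rewrite (chart_natural chartS) t'P tv.
  rewrite /point2 to_diffE; apply/to_quoE; split.
    by rewrite rmorphB v'0; apply: ideal_sym.
  exists (fun l' => - \sum_l (N i l)%:MP * d l l') => j.
  rewrite raddfB v'1; have -> : nv' i j - linear_part j (v i) =
    - \sum_l (N i l)%:MP * Mn l j by rewrite /nv' addrAC subrr add0r.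
  have -> : \sum_l' (- \sum_l (N i l)%:MP * d l l') * (f l')^`M(j) =
      - \sum_l (N i l)%:MP * \sum_l' d l l' * (f l')^`M(j).
    rewrite -sumrN; under [RHS]eq_bigr => l _ do rewrite -mulrN -sumrN mulr_sumr.
    rewrite exchange_big; apply: eq_bigr => l' _ /=.
    rewrite mulNr mulr_suml -sumrN; apply: eq_bigr => l _.
    by rewrite mulrN mulrA.
  rewrite opprK addrC; apply: ideal_eq_sum => l _; rewrite -mulrBr.
  by apply: idealM; apply: ideal_sym; apply: dP.
(* This lifts the shifted point to dual numbers. The linear parts of its coordinates form E: their
   reduction to differentials gives the splitting identity, and the equations of S at g say that E
   is tangential. *)
pose g := (u * t')%g.
have Sg : S g by apply: SM.
have gs : gmap to_diff g = s by rewrite gmapM t't mulVKg.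
have [w wP] := choice (fun i => to_quo_surj (co g i)).
have gw : co g =1 point2 (dual_ideal f) w by move=> i; rewrite -wP.
have diff_w i : differential_ideal f (w i - (('X_i)%:MP + 'X_i)).
  apply/to_quoE; rewrite -to_diffE; have := sP i.
  by rewrite -gs (chart_natural chartS) gw.
have [c cP] := choice (fun i => (diff_w i).2).
have w0 i : I (constant_part (w i) - 'X_i).
  by have [] := diff_w i; rewrite rmorphB rmorphD constant_partC constant_partX addr0.
exists (fun i j => linear_part j (w i)), (fun i l => - c i l); split=> [i j|l j].
  have := cP i j; rewrite raddfB raddfD linear_partC add0r linear_partX => /idealN.
  have -> : \sum_l - c i l * (f l)^`M(j) = - \sum_l c i l * (f l)^`M(j).
    by rewrite -sumrN; apply: eq_bigr => l _; rewrite mulNr.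
  by rewrite opprB opprB addrC opprK.
have [_ /(_ j)] := (zero_of_point2 _ _ _).1
  (zero_of_ext gw ((chart_zero chartS g).1 Sg)) l.
rewrite linear_part_eval; apply: ideal_congr; apply: ideal_eq_sum => i _.
rewrite -mulrBl; apply: idealMr; apply: ideal_sym.
rewrite constant_part_eval -[X in _ - X]meval_at_id.
exact: meval_at_congr.
Qed.

Theorem cartier_certificate : (forall k, k.+1%:R != 0 :> K) -> smooth_certificate f.
Proof.
move=> char0; have [E [c [E_split E_deriv]]] := differential_splitting.
exact: retraction_certificate E_split E_deriv.
Qed.

End Cartier.

(** * Ultraproducts of fields *)

Record maximal_ideal (S : comPzRingType) := MaximalIdeal {
  max_ideal :> ideal S;
  max_ideal_proper : ~ max_ideal 1;
  max_ideal_inv : forall a, ~ max_ideal a -> exists b, max_ideal (b * a - 1) }.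

Lemma maximal_ideal_exists (S : comPzRingType) (D0 : ideal S) :
  ~ D0 1 -> exists D : maximal_ideal S, forall x, D0 x -> D x.
Proof.
move=> D01; pose T := {D : ideal S | (forall x, D0 x -> D x) /\ ~ D 1}.
pose mkT (D : ideal S) HD : T := exist _ D HD.
pose t0 := mkT D0 (conj (fun x D0x => D0x) D01).
pose le (D E : T) := `[< forall x, sval D x -> sval E x >].
have [|||[D [D0D D1]] Dmax] := @classical_sets.ZL_preorder T t0 le.
- by move=> D; apply/asboolP.
- by move=> D E F /asboolP DE /asboolP EF; apply/asboolP => x /DE/EF.
(* [D0] is joined to the union so that the empty chain is bounded too. *)
- move=> A Atot; pose U x := D0 x \/ exists2 D, A D & sval D x.
  have sub (D : T) x : D0 x -> sval D x by case: (svalP D) => + _; apply.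
  have [U0 UD UM] : [/\ U 0, forall x y, U x -> U y -> U (x + y) &
      forall a x, U x -> U (a * x)].
    split=> [|x y [D0x|[D AD Dx]] [D0y|[E AE Ey]]|a x [D0x|[D AD Dx]]].
    + by left; apply: ideal0.
    + by left; apply: idealD.
    + by right; exists E => //; apply: idealD => //; apply: sub.
    + by right; exists D => //; apply: idealD => //; apply: sub.
    + right; have [/asboolP DE|/asboolP ED] := Atot D E AD AE.
        by exists E => //; apply: idealD => //; apply: DE.
      by exists D => //; apply: idealD => //; apply: ED.
    + by left; apply: idealM.
    + by right; exists D => //; apply: idealM.
  have UP : (forall x, D0 x -> Ideal U0 UD UM x) /\ ~ Ideal U0 UD UM 1.
    split=> [x D0x|[//|[D _ D1]]]; first by left.
    by case: (svalP D).
  by exists (mkT _ UP) => D AD; apply/asboolP => x Dx; right; exists D.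
have inv a : ~ D a -> exists b, D (b * a - 1).
  move=> nDa; pose a1 (_ : 'I_1) := a; pose E := ideal_sum2 D (ideal_span a1).
  have DE x : D x -> E x by exists x => //; rewrite subrr; apply: ideal0.
  have [[y Dy [c]]|nE1] := pselect (E 1).
    rewrite big_ord1 => cy; exists (c ord0).
    by rewrite -[c _ * a]/(c ord0 * a1 ord0) -cy addrAC subrr add0r; apply: idealN.
  have EP : (forall x, D0 x -> E x) /\ ~ E 1 by split=> // x /D0D/DE.
  have /asboolP/(_ a) /= ED := Dmax (mkT E EP) (introT (asboolP _) DE).
  case: nDa; apply: ED; exists 0; first exact: ideal0.
  by rewrite subr0; apply: (ideal_span_gen a1 ord0).
by exists (MaximalIdeal D1 inv).
Qed.

Section ResidueField.
Variables (S : comPzRingType) (D : maximal_ideal S).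

Definition residue_field := quo D.

HB.instance Definition _ := GRing.ComPzRing.on residue_field.

Lemma residue_field_nonzero : (1 : residue_field) != 0.
Proof.
apply/eqP => D1; apply: (@max_ideal_proper _ D); apply/to_quo_eq0.
by rewrite rmorph1.
Qed.

HB.instance Definition _ :=
  GRing.PzSemiRing_isNonZero.Build residue_field residue_field_nonzero.

Lemma residue_field_mulVx (x : residue_field) : exists y : residue_field,
  (x != 0 -> y * x = 1) /\ (x = 0 -> y = 0).
Proof.
have [->|x0] := eqVneq x 0; first by exists 0; split=> //; rewrite eqxx.
have [a ax] := to_quo_surj x.
have [|b bP] := @max_ideal_inv _ D a.
  by move=> /to_quo_eq0 a0; move: x0; rewrite -ax a0 eqxx.
exists (to_quo D b); split=> [_|x00]; last by rewrite x00 eqxx in x0.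
by rewrite -ax -(rmorphM (to_quo D)) -[RHS](rmorph1 (to_quo D)); apply/to_quoE.
Qed.

Definition residue_inv (x : residue_field) : residue_field :=
  projT1 (cid (residue_field_mulVx x)).

Lemma residue_mulVf x : x != 0 -> residue_inv x * x = 1.
Proof. by case: (projT2 (cid (residue_field_mulVx x))). Qed.

Lemma residue_inv0 : residue_inv 0 = 0.
Proof. by case: (projT2 (cid (residue_field_mulVx 0))) => _; apply. Qed.

HB.instance Definition _ :=
  GRing.ComNzRing_isField.Build residue_field residue_mulVf residue_inv0.

Definition residue_map : {rmorphism S -> residue_field} := to_quo D.

End ResidueField.

Section Product.
Variable k : nat -> fieldType.

Definition product := forall i, k i.

HB.instance Definition _ := gen_eqMixin product.
HB.instance Definition _ := gen_choiceMixin product.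

Implicit Types a b c : product.

Definition product_zero : product := fun=> 0.
Definition product_one : product := fun=> 1.
Definition product_add a b : product := fun i => a i + b i.
Definition product_opp a : product := fun i => - a i.
Definition product_mul a b : product := fun i => a i * b i.

Lemma productP a b : (forall i, a i = b i) -> a = b.
Proof. exact: functional_extensionality_dep. Qed.

Lemma product_addA : associative product_add.
Proof. by move=> a b c; apply: productP => i; apply: addrA. Qed.
Lemma product_addC : commutative product_add.
Proof. by move=> a b; apply: productP => i; apply: addrC. Qed.
Lemma product_add0 : left_id product_zero product_add.
Proof. by move=> a; apply: productP => i; apply: add0r. Qed.
Lemma product_addN : left_inverse product_zero product_opp product_add.
Proof. by move=> a; apply: productP => i; apply: addNr. Qed.

HB.instance Definition _ := GRing.isZmodule.Build product
  product_addA product_addC product_add0 product_addN.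

Lemma product_mulA : associative product_mul.
Proof. by move=> a b c; apply: productP => i; apply: mulrA. Qed.
Lemma product_mulC : commutative product_mul.
Proof. by move=> a b; apply: productP => i; apply: mulrC. Qed.
Lemma product_mul1 : left_id product_one product_mul.
Proof. by move=> a; apply: productP => i; apply: mul1r. Qed.
Lemma product_mulDl : left_distributive product_mul product_add.
Proof. by move=> a b c; apply: productP => i; apply: mulrDl. Qed.
Lemma product_nonzero : product_one != 0.
Proof.
apply/eqP => /(congr1 (fun a : product => a 0)) /eqP.
by rewrite (negbTE (oner_neq0 (k 0))).
Qed.

HB.instance Definition _ := GRing.Zmodule_isComNzRing.Build product
  product_mulA product_mulC product_mul1 product_mulDl product_nonzero.

Definition proj_fun i (a : product) : k i := a i.

Lemma proj_zmod_morphism i : zmod_morphism (proj_fun i).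
Proof. by []. Qed.

Lemma proj_monoid_morphism i : monoid_morphism (proj_fun i).
Proof. by []. Qed.

HB.instance Definition _ i := GRing.isZmodMorphism.Build product (k i)
  (proj_fun i) (proj_zmod_morphism i).
HB.instance Definition _ i := GRing.isMonoidMorphism.Build product (k i)
  (proj_fun i) (proj_monoid_morphism i).

Definition proj i : {rmorphism product -> k i} := proj_fun i.

Lemma projP a b : (forall i, proj i a = proj i b) -> a = b.
Proof. exact: productP. Qed.

Definition product_map (R : comNzRingType) (phi : forall i, {rmorphism R -> k i})
  (r : R) : product := fun i => phi i r.

Lemma product_map_zmod_morphism R phi : zmod_morphism (@product_map R phi).
Proof. by move=> x y; apply: productP => i; apply: rmorphB. Qed.

Lemma product_map_monoid_morphism R phi : monoid_morphism (@product_map R phi).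
Proof.
by split=> [|x y]; apply: productP => i; [apply: rmorph1|apply: rmorphM].
Qed.

HB.instance Definition _ (R : comNzRingType)
  (phi : forall i, {rmorphism R -> k i}) := GRing.isZmodMorphism.Build R product
  (@product_map R phi) (@product_map_zmod_morphism R phi).
HB.instance Definition _ (R : comNzRingType)
  (phi : forall i, {rmorphism R -> k i}) := GRing.isMonoidMorphism.Build R product
  (@product_map R phi) (@product_map_monoid_morphism R phi).

(** A maximal ideal above this one forgets any finite set of factors, which makes the residue field
    depend only on the tail of the sequence. *)
Definition finite_support : ideal product.
Proof.
apply: (@Ideal product (fun a => exists N, forall i, (N <= i)%N -> a i = 0)).
- by exists 0.
- move=> a b [M aM] [N bN]; exists (maxn M N) => i; rewrite geq_max => /andP[Mi Ni].
  by rewrite -[(a + b) i]/(a i + b i) aM ?bN ?addr0.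
- move=> a b [N bN]; exists N => i Ni.
  by rewrite -[(a * b) i]/(a i * b i) bN ?mulr0.
Defined.

Section Ultraproduct.
Variable D : maximal_ideal product.
Hypothesis D_finite : forall a, finite_support a -> D a.

(* If the elements of [s] had no common zero, then 1 would be a combination of
   idempotents multiple of elements of [s]. *)
Lemma ultraproduct_transfer (s : seq product) :
  (forall a, a \in s -> residue_map D a = 0) -> exists i, forall a, a \in s -> a i = 0.
Proof.
move=> s0; apply: contrapT => nozero.
pose e (s : seq product) : product := fun i => (has (fun a : product => a i != 0) s)%:R.
suff De : D (e s).
  apply: (@max_ideal_proper _ D); suff <- : e s = 1 by [].
  apply: productP => i; rewrite /e; case: hasP => // all0; case: nozero; exists i => a sa.
  by apply/eqP; apply: contraT => ai; case: all0; exists a.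
elim: s s0 {nozero} => [|a s IHs] s0.
  by suff -> : e [::] = 0 by apply: ideal0.
have Da : D a by apply/to_quo_eq0/s0/mem_head.
have Ds : D (e s) by apply: IHs => b sb; apply: s0; rewrite inE sb orbT.
pose ea : product := fun i => (a i)^-1 * a i.
have Dea : D ea by apply: (idealM (i := D) (fun i => (a i)^-1)).
suff -> : e (a :: s) = ea + (1 - ea) * e s.
  by apply: idealD => //; apply: idealM.
apply: productP => i; rewrite -[RHS]/(ea i + (1 - ea i) * e s i) /e /ea /=.
case: eqVneq => [->|ai] /=; first by rewrite mulr0 add0r subr0 mul1r.
by rewrite mulVf // subrr mul0r addr0.
Qed.

Lemma ultraproduct_char0 :
  (forall i d, (d < i)%N -> d.+1%:R != 0 :> k i) ->
  forall d, d.+1%:R != 0 :> residue_field D.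
Proof.
move=> k_char d; apply/eqP => d0.
have Dd : D d.+1%:R by apply/to_quo_eq0; rewrite rmorph_nat.
(* From index d + 1 on, b is a genuine inverse of d + 1; the finitely many other factors are
   absorbed by D. *)
apply: (@max_ideal_proper _ D); pose b : product := fun i => d.+1%:R^-1.
apply: (@ideal_congr _ D 1 (b * d.+1%:R)); last exact: idealM.
apply: D_finite; exists d.+1 => i lt_di.
have -> : (1 - b * d.+1%:R) i = proj i 1 - b i * proj i d.+1%:R by [].
by rewrite rmorph1 rmorph_nat mulVf ?subrr // k_char.
Qed.

End Ultraproduct.

Lemma finite_support_proper : ~ finite_support 1.
Proof. by case=> N /(_ N (leqnn N)) /eqP; rewrite (negbTE (oner_neq0 (k N))). Qed.

Lemma ultraproduct_exists :
  (forall i d, (d < i)%N -> d.+1%:R != 0 :> k i) ->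
  exists (K : fieldType) (chi : {rmorphism product -> K}),
  [/\ forall d, d.+1%:R != 0 :> K, forall y, exists a, chi a = y &
      forall s : seq product, (forall a, a \in s -> chi a = 0) ->
        exists i, forall a, a \in s -> a i = 0].
Proof.
move=> k_char; have [D D_finite] := maximal_ideal_exists finite_support_proper.
exists (residue_field D), (residue_map D); split.
- exact: ultraproduct_char0.
- exact: to_quo_surj.
- exact: ultraproduct_transfer.
Qed.

End Product.

Lemma map_mpoly_deriv n (R R' : comNzRingType) (chi : {rmorphism R -> R'})
    (i : 'I_n) (p : {mpoly R[n]}) :
  map_mpoly chi p^`M(i) = (map_mpoly chi p)^`M(i).
Proof.
apply/mpolyP => m.
by rewrite mcoeff_map_mpoly !mcoeff_deriv mcoeff_map_mpoly raddfMn.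
Qed.

Lemma map_mpoly_surj n (R R' : comNzRingType) (chi : {rmorphism R -> R'}) :
  (forall y, exists x, chi x = y) ->
  forall p : {mpoly R'[n]}, exists q : {mpoly R[n]}, map_mpoly chi q = p.
Proof.
move=> surj; apply: mpoly_ring_ind => [c|i|p q [p' <-] [q' <-]|p q [p' <-] [q' <-]].
- by have [x <-] := surj c; exists x%:MP; rewrite map_mpolyC.
- by exists 'X_i; rewrite map_mpolyX.
- by exists (p' + q'); rewrite rmorphD.
- by exists (p' * q'); rewrite rmorphM.
Qed.

Section UniformCertificates.
Variables (R : comNzRingType) (N n m : nat) (eps : 'M[R]_N).
Variable F : forall k : comNzRingType, {rmorphism R -> k} -> 'M[k]_N ->
  'I_m -> {mpoly k[n]}.

(* Row vectors: [A] is a projector whose row space lies in that of [eps], which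
   will be V inside a free module. *)
Definition good_projector (k : comNzRingType) (phi : {rmorphism R -> k})
    (A : 'M[k]_N) : Prop :=
  A *m A = A /\ A *m map_mx phi eps = A.

Hypothesis F_natural : forall (k k' : comNzRingType) (chi : {rmorphism k -> k'})
    (phi : {rmorphism R -> k}) (phi' : {rmorphism R -> k'}) (A : 'M[k]_N) l,
  phi' =1 chi \o phi ->
  map_mpoly chi (F phi A l) = F phi' (map_mx chi A) l.
Hypothesis F_char0 : forall (K : fieldType) (phi : {rmorphism R -> K}) (A : 'M[K]_N),
  (forall d, d.+1%:R != 0 :> K) -> good_projector phi A -> smooth_certificate (F phi A).

Lemma good_projector_natural (k k' : comNzRingType) (chi : {rmorphism k -> k'})
    (phi : {rmorphism R -> k}) A :
  good_projector phi A -> good_projector (chi \o phi) (map_mx chi A).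
Proof.
case=> AA Aeps; split; first by rewrite -map_mxM AA.
have -> : map_mx (chi \o phi) eps = map_mx chi (map_mx phi eps).
  by apply/matrixP => a b; rewrite !mxE.
by rewrite -map_mxM Aeps.
Qed.

(** A compactness argument. [F] is given over all nonzero commutative rings so that it can be formed
    over the product of the bad fields and specialised both to each factor and to the
    ultraproduct. *)
Theorem uniform_certificate : exists N0 : nat,
  forall (k : fieldType) (phi : {rmorphism R -> k}) (A : 'M[k]_N),
  (forall d, (d < N0)%N -> d.+1%:R != 0 :> k) ->
  good_projector phi A -> smooth_certificate (F phi A).
Proof.
apply: contrapT => none.
have bad N0 : exists x : {k : fieldType & ({rmorphism R -> k} * 'M[k]_N)%type},
    [/\ forall d, (d < N0)%N -> d.+1%:R != 0 :> tag x,
        good_projector (tagged x).1 (tagged x).2 &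
        ~ smooth_certificate (F (tagged x).1 (tagged x).2)].
  apply: contrapT => nobad; apply: none; exists N0 => k phi A k_char gA.
  by apply: contrapT => nA; apply: nobad; exists (existT _ k (phi, A)).
have [x xP] := choice bad.
pose k i := tag (x i); pose phi i : {rmorphism R -> k i} := (tagged (x i)).1.
pose A i : 'M[k i]_N := (tagged (x i)).2.
pose Phi : {rmorphism R -> product k} := product_map phi.
pose B : 'M[product k]_N := \matrix_(a, b) (fun i => A i a b).
have projB i : map_mx (proj k i) B = A i.
  by apply/matrixP => a b; rewrite !mxE.
have gB : good_projector Phi B.
  have gA i : good_projector (phi i) (A i) by case: (xP i).
  split; apply/matrixP => a b; apply: projP => i.
    have [/matrixP/(_ a b) AA _] := gA i; move: AA.
    by rewrite -(projB i) -map_mxM !mxE.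
  have [_ /matrixP/(_ a b) Ae] := gA i; move: Ae; rewrite -{2}(projB i) [RHS]mxE => <-.
  have -> : map_mx (phi i) eps = map_mx (proj k i) (map_mx Phi eps).
    by apply/matrixP => a' b'; rewrite !mxE.
  by rewrite -(projB i) -map_mxM [RHS]mxE.
have [|K [chi [K_char0 surj transfer]]] := @ultraproduct_exists k.
  by move=> i d; case: (xP i) => + _ _; apply.
have gK : good_projector (chi \o Phi) (map_mx chi B) by apply: good_projector_natural.
have [h hP] := F_char0 K_char0 gK.
have [c cP] := choice hP.
(* The certificate over K is lifted along the surjection [chi]. Over the product it holds up to the
   defects [r j], which [chi] kills. *)
have [H HP] := choice (fun il => map_mpoly_surj surj (h il.1 il.2)).
have [C CP] := choice (fun jab => map_mpoly_surj surj (c jab.1 jab.2.1 jab.2.2)).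
pose rhs (k' : comNzRingType) (f : 'I_m -> {mpoly k'[n]}) h' c' j :=
  \sum_i (\sum_l h' i l * f l) * (f j)^`M(i) + \sum_a \sum_b c' a b * f a * f b.
pose hS i l := H (i, l); pose cS j a b := C (j, (a, b)).
pose f := F Phi B.
have map_rhs (k' : comNzRingType) (psi : {rmorphism product k -> k'}) j :
    map_mpoly psi (rhs _ f hS (cS j) j) =
    rhs _ (fun l => map_mpoly psi (f l)) (fun i l => map_mpoly psi (hS i l))
      (fun a b => map_mpoly psi (cS j a b)) j.
  rewrite /rhs rmorphD !rmorph_sum /=; congr (_ + _); apply: eq_bigr => a _.
    rewrite rmorphM rmorph_sum /= map_mpoly_deriv; congr (_ * _).
    by apply: eq_bigr => l _; rewrite rmorphM.
  by rewrite rmorph_sum; apply: eq_bigr => b _; rewrite !rmorphM.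
pose r j := f j - rhs _ f hS (cS j) j.
have r0 j : map_mpoly chi (r j) = 0.
  rewrite rmorphB /= map_rhs; apply/eqP; rewrite subr_eq0; apply/eqP.
  have fE l : map_mpoly chi (f l) = F (chi \o Phi) (map_mx chi B) l by apply: F_natural.
  rewrite fE cP /rhs; congr (_ + _); apply: eq_bigr => a _.
    rewrite fE; congr (_ * _); apply: eq_bigr => l _.
    by rewrite fE (HP (a, l)).
  by apply: eq_bigr => b _; rewrite !fE (CP (j, (a, b))).
(* Finitely many coefficients vanish in K, so they vanish together in some factor i, where the
   lifted certificate becomes a true one. *)
pose s := flatten [seq [seq (r j)@_mm | mm <- msupp (r j)] | j <- enum 'I_m].
have [|i iP] := transfer s.
  move=> z /flatten_mapP[j _ /mapP[mm _ ->]].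
  by rewrite -mcoeff_map_mpoly r0 mcoeff0.
have ri j : map_mpoly (proj k i) (r j) = 0.
  apply/mpolyP => mm; rewrite mcoeff_map_mpoly mcoeff0.
  have [mm_r|] := boolP (mm \in msupp (r j)); last by move/memN_msupp_eq0->; rewrite raddf0.
  apply: iP; apply/flatten_mapP; exists j; first exact: mem_enum.
  by apply/mapP; exists mm.
case: (xP i) => _ _; apply.
have -> : F (tagged (x i)).1 (tagged (x i)).2 = fun l => map_mpoly (proj k i) (f l).
  apply/funext => l; have := @F_natural _ _ (proj k i) Phi (phi i) B l (fun=> erefl).
  by rewrite projB => ->.
move: (proj k i) ri => psi ri.
exists (fun i' l => map_mpoly psi (hS i' l)) => j.
exists (fun a b => map_mpoly psi (cS j a b)).
by have := ri j; rewrite rmorphB /= map_rhs => /subr0_eq.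
Qed.

End UniformCertificates.

(** * Equations of subgroups *)

Lemma algebraic_group_chart (R : comNzRingType) (G : group_functor R) :
  algebraic_group G ->
  exists n m (s : 'I_m -> {mpoly R[n]}) (co : forall Q : algebra R, G Q -> 'I_n -> Q),
    chart (fun _ _ => True) s co.
Proof.
case=> A [[n [fA [surj [m [s ker]]]]] [ev [ev_nat ev_inj ev_surj]]].
have ex Q (g : G Q) : exists h, ev Q h = g by apply/(ev_surj Q g).
pose hg Q g := projT1 (cid (ex Q g)).
have hgP Q g : ev Q (hg Q g) = g by apply: projT2 (cid (ex Q g)).
pose co Q (g : G Q) i := hg Q g (fA 'X_i).
have co_eval Q g p : meval_at (structure_map Q) (co Q g) p = hg Q g (fA p).
  apply: (mpoly_morph_ext (g := meval_at (structure_map Q) (co Q g))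
    (h := hg Q g \o fA)) => [c|i] /=.
    by rewrite meval_atC -(hom_structure (hg Q g)) -(hom_structure fA).
  by rewrite meval_atX.
exists n, m, s, co; split.
- move=> Q Q' h g i; rewrite /co.
  suff -> : hg Q' (gmap h g) = hom_comp h (hg Q g) by [].
  by apply: ev_inj; rewrite hgP -ev_nat hgP.
- move=> Q g g' gg'; rewrite -(hgP Q g) -(hgP Q g'); congr ev.
  apply: algebra_hom_ext => a; have [p <-] := surj a.
  by rewrite -!co_eval; apply: eq_meval_at.
- move=> Q g; split=> // _ l; rewrite co_eval.
  have /ker -> : ideal_span s (s l) by apply: ideal_span_gen.
  exact: rmorph0.
- move=> Q q sq.
  have kill p : fA p = 0 -> meval_at (structure_map Q) q p = 0.
    by move=> /ker; apply: zero_of_span.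
  pose u := factor surj kill.
  have u_str r : u (structure_map A r) = structure_map Q r.
    by rewrite -(hom_structure fA) factorE; apply: meval_atC.
  exists (ev Q (AlgebraHom u_str)) => i; rewrite /co.
  have -> : hg Q (ev Q (AlgebraHom u_str)) = AlgebraHom u_str by apply: ev_inj.
  exact: (etrans (factorE surj kill _) (meval_atX _ _ _)).
Qed.

(** Yoneda: p represents the value at the universal point over the coordinate ring, and every point
    is an image of that one. *)
Lemma natural_function_poly (R : comNzRingType) (G : group_functor R) n m
    (s : 'I_m -> {mpoly R[n]}) (co : forall Q : algebra R, G Q -> 'I_n -> Q)
    (theta : forall Q : algebra R, G Q -> Q) :
  chart (fun _ _ => True) s co ->
  (forall Q Q' (h : algebra_hom Q Q') g, theta Q' (gmap h g) = h (theta Q g)) ->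
  exists p, forall Q g, theta Q g = meval_at (structure_map Q) (co Q g) p.
Proof.
move=> chartG theta_nat.
have zero0 : zero_of s (coordinate s).
  apply: zero_of_ext (quotient_hom_zero (hom_id (quotient_algebra s))) => i.
  by [].
have [g0 g0P] := chart_surj chartG zero0.
have [p pP] := to_quo_surj (theta _ g0).
exists p => Q g; have fg := (chart_zero chartG g).1 I.
have -> : g = gmap (point_hom fg) g0.
  apply: (chart_inj chartG) => i.
  by rewrite (chart_natural chartG) g0P point_hom_coordinate.
rewrite theta_nat -pP quotient_hom_eval; apply: eq_meval_at => // i /=.
by rewrite (chart_natural chartG) g0P.
Qed.

Lemma natural_matrix_poly (R : comNzRingType) (G : group_functor R) n m
    (s : 'I_m -> {mpoly R[n]}) (co : forall Q : algebra R, G Q -> 'I_n -> Q) N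
    (theta : forall Q : algebra R, G Q -> 'M[Q]_N) :
  chart (fun _ _ => True) s co ->
  (forall Q Q' (h : algebra_hom Q Q') g, theta Q' (gmap h g) = map_mx h (theta Q g)) ->
  exists B : 'M[{mpoly R[n]}]_N, forall Q g,
    theta Q g = map_mx (meval_at (structure_map Q) (co Q g)) B.
Proof.
move=> chartG theta_nat.
have ex (ij : 'I_N * 'I_N) : exists p, forall Q (g : G Q),
    theta Q g ij.1 ij.2 = meval_at (structure_map Q) (co Q g) p.
  apply: (natural_function_poly (theta := fun Q g => theta Q g ij.1 ij.2) chartG).
  by move=> Q Q' h g; rewrite theta_nat mxE.
have [B BP] := choice ex; exists (\matrix_(i, j) B (i, j)) => Q g.
by apply/matrixP => i j; rewrite !mxE -(BP (i, j)).
Qed.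

Section MatrixSystem.
Variables (k : comNzRingType) (n m p q : nat).

Definition matrix_system (s : 'I_m -> {mpoly k[n]}) (C : 'M[{mpoly k[n]}]_(p, q))
    (l : 'I_(m + p * q)) : {mpoly k[n]} :=
  row_mx (\row_i s i) (mxvec C) 0 l.

Lemma zero_of_matrix_system s C (Q : algebra k) (x : 'I_n -> Q) :
  zero_of (matrix_system s C) x <->
  zero_of s x /\ map_mx (meval_at (structure_map Q) x) C = 0.
Proof.
set ev := meval_at _ _; split=> [sCx|[sx Cx] l].
  have : map_mx ev (row_mx (\row_i s i) (mxvec C)) = 0.
    by apply/rowP => l; rewrite !mxE -[RHS](sCx l) /matrix_system mxE.
  rewrite map_row_mx map_mxvec -row_mx0 => /eq_row_mx[/rowP sx /eqP].
  rewrite mxvec_eq0 => /eqP Cx; split=> // l.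
  by have := sx l; rewrite !mxE.
have : map_mx ev (row_mx (\row_i s i) (mxvec C)) = 0.
  rewrite map_row_mx map_mxvec Cx linear0 -[RHS]row_mx0; congr row_mx.
  by apply/rowP => i; rewrite !mxE; apply: sx.
by move/rowP/(_ l); rewrite [LHS]mxE [RHS]mxE.
Qed.

End MatrixSystem.

Lemma map_matrix_system (k k' : comNzRingType) n m p q (chi : {rmorphism k -> k'})
    (s : 'I_m -> {mpoly k[n]}) (C : 'M[{mpoly k[n]}]_(p, q)) l :
  map_mpoly chi (matrix_system s C l) =
  matrix_system (fun i => map_mpoly chi (s i)) (map_mx (map_mpoly chi) C) l.
Proof.
rewrite /matrix_system -map_mxvec.
have -> : \row_i map_mpoly chi (s i) = map_mx (map_mpoly chi) (\row_i s i).
  by apply/rowP => i; rewrite !mxE.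
by rewrite -map_row_mx [RHS]mxE.
Qed.

Section BaseChangeChart.
Variables (R : comNzRingType) (G : group_functor R) (n m : nat).
Variables (s : 'I_m -> {mpoly R[n]}) (co : forall Q : algebra R, G Q -> 'I_n -> Q).
Hypothesis chartG : chart (fun _ _ => True) s co.
Variables (k : comNzRingType) (phi : {rmorphism R -> k}).
Local Notation Gk := (base_change_group phi G).

Definition base_change_co (Q : algebra k) (g : Gk Q) : 'I_n -> Q :=
  @co (restrict phi Q) g.

Lemma base_change_eval (Q : algebra k) (x : 'I_n -> Q) p :
  meval_at (structure_map Q) x (map_mpoly phi p) =
  meval_at (structure_map (restrict phi Q)) x p.
Proof. exact: meval_at_map. Qed.

Lemma base_change_zero (Q : algebra k) (x : 'I_n -> Q) :
  zero_of (fun i => map_mpoly phi (s i)) x <-> @zero_of R n m s (restrict phi Q) x.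
Proof. by split=> sx l; [rewrite -base_change_eval|rewrite base_change_eval]. Qed.

Lemma base_change_chart p q (C : 'M[{mpoly k[n]}]_(p, q))
    (S : forall Q, Gk Q -> Prop) :
  (forall Q g, S Q g <->
    map_mx (meval_at (structure_map Q) (base_change_co g)) C = 0) ->
  chart S (matrix_system (fun i => map_mpoly phi (s i)) C) base_change_co.
Proof.
move=> SC; split.
- by move=> Q Q' h g i; apply: (chart_natural chartG (restrict_hom phi h)).
- by move=> Q g g'; apply: (@chart_inj _ _ _ _ _ _ _ chartG (restrict phi Q)).
- move=> Q g; split=> [/SC Cg|/zero_of_matrix_system[_ /SC //]].
  apply/zero_of_matrix_system; split=> //; apply/base_change_zero.
  exact/(chart_zero chartG).
- move=> Q x /zero_of_matrix_system[/base_change_zero sx _].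
  exact: (chart_surj chartG).
Qed.

End BaseChangeChart.

(** * Coordinates on V *)

Record dual_basis (R : comNzRingType) (V : lmodType R) N (e : 'I_N -> V)
    (coord : 'I_N -> V -> R) : Prop := DualBasis {
  coordD : forall i v w, coord i (v + w) = coord i v + coord i w;
  coordZ : forall i r v, coord i (r *: v) = r * coord i v;
  coord_sum : forall v, v = \sum_i coord i v *: e i }.

Lemma projective_dual_basis (R : comNzRingType) (V : lmodType R) :
  finitely_generated V -> projective V ->
  exists N (e : 'I_N -> V) coord, dual_basis e coord.
Proof.
case=> N [e egen] proj.
pose g (c : 'rV[R]_N) : V := \sum_i c 0 i *: e i.
have g_lin : linear g.
  move=> a c d; rewrite scaler_sumr -big_split; apply: eq_bigr => i _ /=.
  by rewrite !mxE scalerDl scalerA.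
pose gL : {linear 'rV[R]_N -> V} := HB.pack g (GRing.isLinear.Build _ _ _ _ g g_lin).
have [|h hP] := proj _ _ gL (idfun : {linear V -> V}).
  move=> v; have [c ->] := egen v; exists (\row_i c i).
  by apply: eq_bigr => i _; rewrite mxE.
exists N, e, (fun i v => h v 0 i); split=> [i v w|i r v|v].
- by rewrite linearD mxE.
- by rewrite linearZ mxE.
- by rewrite -[LHS]hP.
Qed.

Lemma pure_tensor_scale (R : comPzRingType) (V : lmodType R) (Q : algebra R)
    (v : V) (a b : Q) :
  a *: pure_tensor v b = pure_tensor v (a * b).
Proof.
apply: tensor_ext => M c cb.
rewrite (tensor_liftZ cb) !tensor_lift_pure //.
exact: balanced_scale.
Qed.

Section Coordinates.
Variables (R : comNzRingType) (V : lmodType R) (N : nat).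
Variables (e : 'I_N -> V) (coord : 'I_N -> V -> R).
Hypothesis basis : dual_basis e coord.

Definition coord_form (Q : algebra R) i (v : V) (q : Q) : Q :=
  structure_map Q (coord i v) * q.

Lemma coord_form_balanced (Q : algebra R) i : balanced (@coord_form Q i).
Proof.
split=> [v w q|v q q'|r v q]; rewrite /coord_form.
- by rewrite (coordD basis) rmorphD mulrDl.
- exact: mulrDr.
- by rewrite (coordZ basis) rmorphM mulrA [_ * structure_map _ _]mulrC.
Qed.

Definition tensor_row (Q : algebra R) (x : tensor V Q) : 'rV[Q]_N :=
  \row_i tensor_lift (coord_form i) x.

Lemma tensor_rowD (Q : algebra R) (x y : tensor V Q) :
  tensor_row (x + y) = tensor_row x + tensor_row y.
Proof.
by apply/rowP => i; rewrite !mxE; apply: tensor_liftD; apply: coord_form_balanced.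
Qed.

Lemma tensor_rowZ (Q : algebra R) (a : Q) (x : tensor V Q) :
  tensor_row (a *: x) = a *: tensor_row x.
Proof.
apply/rowP => i; rewrite !mxE (tensor_liftZ (coord_form_balanced Q i)).
rewrite /tensor_lift /tensor_eval mulr_sumr; apply: eq_bigr => u _.
exact: mulrCA.
Qed.

Lemma tensor_row0 (Q : algebra R) : tensor_row (0 : tensor V Q) = 0.
Proof. by rewrite -(scale0r 0) tensor_rowZ scale0r. Qed.

Lemma tensor_row_sum (Q : algebra R) (I : finType) (x : I -> tensor V Q) :
  tensor_row (\sum_i x i) = \sum_i tensor_row (x i).
Proof. exact: (big_morph _ (@tensor_rowD Q) (tensor_row0 Q)). Qed.

Lemma tensor_row_map (Q Q' : algebra R) (h : algebra_hom Q Q') (x : tensor V Q) :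
  tensor_row (tensor_map h x) = map_mx h (tensor_row x).
Proof.
apply/rowP => i; rewrite !mxE (tensor_lift_map _ _ (coord_form_balanced Q' i)).
rewrite /tensor_lift /tensor_eval rmorph_sum; apply: eq_bigr => u _.
by rewrite /coord_form rmorphM hom_structure.
Qed.

Lemma tensor_row_expand (Q : algebra R) (x : tensor V Q) :
  x = \sum_i tensor_row x 0 i *: pure_tensor (e i) 1.
Proof.
have pureE (v : V) (q : Q) : pure_tensor v q =
    \sum_i tensor_row (pure_tensor v q) 0 i *: pure_tensor (e i) 1.
  have pb := pure_tensor_balanced V Q.
  have pure0 : pure_tensor (0 : V) q = 0.
    by rewrite -(scale0r (0 : V)) (balancedZ pb) rmorph0 -pure_tensor_scale scale0r.
  rewrite {1}(coord_sum basis v).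
  rewrite (big_morph (fun v => pure_tensor v q) (fun v w => balancedDl pb v w q) pure0).
  apply: eq_bigr => i _; rewrite mxE (tensor_lift_pure _ _ (coord_form_balanced Q i)).
  by rewrite (balancedZ pb) pure_tensor_scale mulr1.
have [s <-] : exists s, tensor_sum s = x by exists (repr x); apply: reprK.
rewrite tensor_sumE; elim: s => [|u s IHs].
  by rewrite big_nil big1 // => i _; rewrite tensor_row0 mxE scale0r.
rewrite big_cons {1}(pureE u.1 u.2) {1}IHs -big_split; apply: eq_bigr => i _ /=.
by rewrite -scalerDl tensor_rowD; congr (_ *: _); rewrite [RHS]mxE.
Qed.

Lemma tensor_row_inj (Q : algebra R) : injective (@tensor_row Q).
Proof. by move=> x y xy; rewrite (tensor_row_expand x) xy -tensor_row_expand. Qed.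

(** The family [e] generates V but need not be free, so this is in general not the identity: it is
    the idempotent that cuts V out of the free module of rank N, and plays the role of [eps] in
    [good_projector]. *)
Definition gram : 'M[R]_N := \matrix_(j, i) coord i (e j).

Lemma tensor_row_basis (Q : algebra R) j :
  tensor_row (pure_tensor (e j) (1 : Q)) = row j (map_mx (structure_map Q) gram).
Proof.
apply/rowP => i; rewrite !mxE (tensor_lift_pure _ _ (coord_form_balanced Q i)).
exact: mulr1.
Qed.

Lemma tensor_row_gram (Q : algebra R) (x : tensor V Q) :
  tensor_row x *m map_mx (structure_map Q) gram = tensor_row x.
Proof.
rewrite [in RHS](tensor_row_expand x) tensor_row_sum mulmx_sum_row.
by apply: eq_bigr => i _; rewrite tensor_rowZ tensor_row_basis.
Qed.

Section Action.
Variables (G : group_functor R) (M : group_module G V).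
Local Notation act := (act M).

(* Coordinates are row vectors, so [action_mx] reverses products. *)
Definition action_mx (Q : algebra R) (g : G Q) : 'M[Q]_N :=
  \matrix_j tensor_row (act g (pure_tensor (e j) 1 : tensor_functor V Q)).

Lemma tensor_row_act (Q : algebra R) (g : G Q) (x : tensor_functor V Q) :
  tensor_row (act g x) = tensor_row x *m action_mx g.
Proof.
have act_lin := module_linear M g.
pose L : {linear tensor V Q -> tensor V Q} :=
  HB.pack (act g : tensor V Q -> tensor V Q) (GRing.isLinear.Build _ _ _ _ _ act_lin).
rewrite {1}(tensor_row_expand x) -[act g _]/(L _) linear_sum tensor_row_sum.
rewrite mulmx_sum_row; apply: eq_bigr => i _.
by rewrite linearZ tensor_rowZ rowK.
Qed.

Lemma action_mxM (Q : algebra R) (g h : G Q) :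
  action_mx (g * h)%g = action_mx h *m action_mx g.
Proof.
by apply/row_matrixP => j; rewrite row_mul !rowK actM tensor_row_act.
Qed.

(** The unit acts by the idempotent of V, so the matrices of the action need not be invertible. The
    condition [A *m map_mx phi eps = A] on projectors makes up for this. *)
Lemma action_mx1 (Q : algebra R) : action_mx (1 : G Q)%g = map_mx (structure_map Q) gram.
Proof. by apply/row_matrixP => j; rewrite rowK act1 tensor_row_basis. Qed.

Lemma action_mx_map (Q Q' : algebra R) (f : algebra_hom Q Q') (g : G Q) :
  action_mx (gmap f g) = map_mx f (action_mx g).
Proof.
apply/row_matrixP => j; rewrite -map_row !rowK -tensor_row_map.
have -> : pure_tensor (e j) (1 : Q') = tensor_map f (pure_tensor (e j) 1).
  apply: tensor_row_inj; rewrite tensor_row_map !tensor_row_basis map_row.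
  by congr row; apply/matrixP => a b; rewrite !mxE hom_structure.
by rewrite -(act_natural M).
Qed.

End Action.
End Coordinates.

(** * Centralisers and normalisers of subspaces *)

Section UniformSmoothness.
Variables (R : comNzRingType) (G : group_functor R) (n m N p q : nat).
Variables (s : 'I_m -> {mpoly R[n]}) (co : forall Q : algebra R, G Q -> 'I_n -> Q).
Hypothesis chartG : chart (fun _ _ => True) s co.
Variable eps : 'M[R]_N.
Variable C : forall k : comNzRingType, {rmorphism R -> k} -> 'M[k]_N ->
  'M[{mpoly k[n]}]_(p, q).
Hypothesis C_natural : forall (k k' : comNzRingType) (chi : {rmorphism k -> k'})
    (phi : {rmorphism R -> k}) (phi' : {rmorphism R -> k'}) (A : 'M[k]_N),
  phi' =1 chi \o phi ->
  map_mx (map_mpoly chi) (C phi A) = C phi' (map_mx chi A).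
Variable S : forall (k : comNzRingType) (phi : {rmorphism R -> k}) (A : 'M[k]_N)
  (Q : algebra k), base_change_group phi G Q -> Prop.
Hypothesis S_zero : forall (k : comNzRingType) (phi : {rmorphism R -> k})
    (A : 'M[k]_N) (Q : algebra k) (g : base_change_group phi G Q),
  S A g <-> map_mx (meval_at (structure_map Q) (base_change_co co g)) (C phi A) = 0.
Hypothesis S_group : forall (k : comNzRingType) (phi : {rmorphism R -> k})
    (A : 'M[k]_N), good_projector eps phi A -> forall Q : algebra k,
  [/\ S A (1%g : base_change_group phi G Q),
      forall g h : base_change_group phi G Q, S A g -> S A h -> S A (g * h)%g &
      forall g : base_change_group phi G Q, S A g -> S A g^-1%g].

(** Common to centralisers and normalisers: all that is used of the subgroup is a matrix of
    equations of fixed size, natural in the base ring, and the group axioms for good projectors. *)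
Theorem uniform_smoothness : exists N0 : nat,
  forall (k : fieldType) (phi : {rmorphism R -> k}) (A : 'M[k]_N),
  (forall d, (d < N0)%N -> d.+1%:R != 0 :> k) ->
  good_projector eps phi A -> smooth_subgroup (S (phi := phi) A).
Proof.
pose F (k : comNzRingType) (phi : {rmorphism R -> k}) (A : 'M[k]_N) :=
  matrix_system (fun i => map_mpoly phi (s i)) (C phi A).
have [|K phi A char0 gA|N0 N0P] := @uniform_certificate R N n _ eps F.
- move=> k k' chi phi phi' A l e; rewrite map_matrix_system (C_natural A e).
  suff -> : (fun i => map_mpoly chi (map_mpoly phi (s i))) =
      fun i => map_mpoly phi' (s i) by [].
  apply/funext => i; apply/mpolyP => mm; rewrite !mcoeff_map_mpoly.
  exact/esym/e.
- have chartK : chart (S (phi := phi) A) (F K phi A) (@base_change_co R G n co K phi).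
    exact: (base_change_chart chartG (S_zero (phi := phi) A)).
  by apply: (cartier_certificate chartK) => // Q; have [] := S_group gA Q.
- exists N0 => k phi A k_char gA; exists (quotient_algebra (F k phi A)); split.
    exact/certificate_smooth/N0P.
  apply: chart_represented.
  exact: (base_change_chart chartG (S_zero (phi := phi) A)).
Qed.

End UniformSmoothness.

(** A matrix of maximal rank with row space inside X exhausts X: one more vector of X would raise
    the rank. *)
Lemma submod_row_space (k : fieldType) N (X : 'rV[k]_N -> Prop) :
  X 0 -> (forall a u v, X u -> X v -> X (a *: u + v)) ->
  exists B : 'M[k]_N, forall v, X v <-> (v <= B)%MS.
Proof.
move=> X0 XD; pose P r := `[< exists2 B : 'M[k]_N,
  (forall v, (v <= B)%MS -> X v) & \rank B = r >].
have exP : exists r, P r.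
  exists 0%N; apply/asboolP; exists 0; last exact: mxrank0.
  by move=> v; rewrite submx0 => /eqP->.
have leP r : P r -> (r <= N)%N.
  by move=> /asboolP[B _ <-]; apply: rank_leq_row.
have [r /asboolP[B BX rB] rmax] := ex_maxnP exP leP.
exists B => v; split=> [Xv|]; last exact: BX.
have XBv : forall w, (w <= B + v)%MS -> X w.
  move=> w /sub_addsmxP[[a b] ->] /=; rewrite addrC [b]mx11_scalar mul_scalar_mx.
  by apply: XD => //; apply: BX; apply: submxMl.
have /rmax le_Bv : P (\rank (B + v)%MS) by apply/asboolP; exists (B + v)%MS.
have /eqmxP/eqmxP : (B :=: B + v)%MS.
  by apply/eqmxP; rewrite -(geq_leqif (mxrank_leqif_eq (addsmxSl B v))) rB.
by move=> BBv; rewrite BBv addsmxSr.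
Qed.

Section Systems.
Variables (R : comNzRingType) (V : lmodType R) (N : nat).
Variables (e : 'I_N -> V) (coord : 'I_N -> V -> R).
Hypothesis basis : dual_basis e coord.
Variables (G : group_functor R) (M : group_module G V).
Local Notation rho := (action_mx e coord M).
Local Notation eps := (gram e coord).
Local Notation row_of := (tensor_row coord).

Section Subgroups.
Variables (k : comNzRingType) (phi : {rmorphism R -> k}) (A : 'M[k]_N).

Definition extend_mx (Q : algebra k) : 'M[restrict phi Q]_N :=
  map_mx (structure_map Q) A.

Definition fixing (Q : algebra k) (g : base_change_group phi G Q) : Prop :=
  extend_mx Q *m rho (Q := restrict phi Q) g = extend_mx Q.

(** For an idempotent A, being fixed by A on the right means lying in its row space; so g sends the
    rows of A into that row space. *)
Definition stabilising (Q : algebra k) (g : base_change_group phi G Q) : Prop :=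
  extend_mx Q *m rho (Q := restrict phi Q) g *m extend_mx Q =
  extend_mx Q *m rho (Q := restrict phi Q) g.

Definition normalising (Q : algebra k) (g : base_change_group phi G Q) : Prop :=
  stabilising g /\ stabilising g^-1%g.

Hypothesis gA : good_projector eps phi A.

Lemma extend_mx_idem Q : extend_mx Q *m extend_mx Q = extend_mx Q.
Proof. by rewrite -map_mxM; case: gA => ->. Qed.

Lemma extend_mx_unit (Q : algebra k) :
  extend_mx Q *m rho (1%g : G (restrict phi Q)) = extend_mx Q.
Proof.
rewrite (action_mx1 basis).
have -> : map_mx (structure_map (restrict phi Q)) eps =
    map_mx (structure_map Q) (map_mx phi eps) by apply/matrixP => a b; rewrite !mxE.
by rewrite -map_mxM; case: gA => _ ->.
Qed.

Lemma fixing_group (Q : algebra k) :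
  [/\ fixing (1%g : base_change_group phi G Q),
      forall g h : base_change_group phi G Q, fixing g -> fixing h -> fixing (g * h)%g &
      forall g : base_change_group phi G Q, fixing g -> fixing g^-1%g].
Proof.
split=> [|g h fg fh|g fg]; rewrite /fixing.
- exact: extend_mx_unit.
- by rewrite (action_mxM basis) mulmxA fh fg.
- have fg1 := action_mxM basis M (g^-1 : G (restrict phi Q))%g g.
  by rewrite -{1}fg -mulmxA -fg1 mulVg; apply: extend_mx_unit.
Qed.

Lemma normalising_group (Q : algebra k) :
  [/\ normalising (1%g : base_change_group phi G Q),
      forall g h : base_change_group phi G Q,
        normalising g -> normalising h -> normalising (g * h)%g &
      forall g : base_change_group phi G Q, normalising g -> normalising g^-1%g].
Proof.
have st1 : stabilising (1%g : base_change_group phi G Q).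
  by rewrite /stabilising extend_mx_unit extend_mx_idem.
have stM (g h : base_change_group phi G Q) :
    stabilising g -> stabilising h -> stabilising (g * h)%g.
  rewrite /stabilising => sg sh; rewrite (action_mxM basis) !mulmxA.
  by rewrite -sh -!mulmxA; congr (_ *m (_ *m _)); rewrite !mulmxA.
split=> [|g h [sg sg'] [sh sh']|g [sg sg']]; split=> //.
- by rewrite invg1.
- exact: stM.
- by rewrite invgM; apply: stM.
- by rewrite invgK.
Qed.

End Subgroups.

Section Subspaces.
Variables (k : fieldType) (phi : {rmorphism R -> k}).
Variable W : {pred tensor V (Algebra phi)}.
Hypothesis W_closed : GRing.submod_closed W.

Lemma subspace_projector : exists A : 'M[k]_N,
  [/\ good_projector eps phi A,
      forall j, exists2 w, w \in W & tensor_row coord w = row j A &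
      forall w, w \in W -> tensor_row coord w *m A = tensor_row coord w].
Proof.
have [W0 WD] := W_closed.
pose X (v : 'rV[k]_N) := exists2 w, w \in W & tensor_row coord w = v.
have X0 : X 0 by exists 0 => //; apply: (tensor_row0 basis).
have XD a u v : X u -> X v -> X (a *: u + v).
  move=> [x Wx <-] [y Wy <-]; exists ((a : Algebra phi) *: x + y); first exact: WD.
  by rewrite (tensor_rowD basis) (tensor_rowZ basis).
have [B BX] := submod_row_space X0 XD.
have XA v : X v -> v *m (pinvmx B *m B) = v.
  by move=> /BX vB; rewrite mulmxA mulmxKpV.
have rowX j : X (row j (pinvmx B *m B)).
  by apply/BX; rewrite row_mul submxMl.
(* The rows of this product lie in the row space of B, on which it acts as the identity. They are
   coordinates of vectors of V, hence fixed by [eps]. *)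
exists (pinvmx B *m B); split=> // [|w Ww]; last by apply: XA; exists w.
split; apply/row_matrixP => j; rewrite row_mul.
  exact: XA.
by have [w _ <-] := rowX j; apply: (tensor_row_gram basis w).
Qed.

Variable A : 'M[k]_N.
Hypothesis gA : good_projector eps phi A.
Hypothesis rowA : forall j, exists2 w, w \in W & tensor_row coord w = row j A.
Hypothesis fixA : forall w, w \in W -> tensor_row coord w *m A = tensor_row coord w.

Lemma tensor_row_structure (Q : algebra k) (w : tensor V (Algebra phi)) :
  tensor_row coord (tensor_map (structure_hom phi Q) w) =
  map_mx (structure_map Q) (tensor_row coord w).
Proof. exact: (tensor_row_map basis). Qed.

(** Points of W over any algebra become solutions of a linear equation. Conversely, the coordinates
    of a solution serve as its coefficients on the vectors of W given by the rows of A. *)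
Lemma subspace_pointsP (Q : algebra k) (x : tensor V (restrict phi Q)) :
  @subspace_points _ _ phi V W Q x <->
  tensor_row coord x *m extend_mx phi A Q = tensor_row coord x.
Proof.
split=> [[n [c [w [Ww ->]]]]|xA].
  rewrite (tensor_row_sum basis) mulmx_suml; apply: eq_bigr => i _.
  rewrite (tensor_rowZ basis) -scalemxAl tensor_row_structure; congr (_ *: _).
  rewrite -[RHS](congr1 (map_mx (structure_map Q)) (fixA (Ww i))).
  exact/esym/map_mxM.
have ex j : exists w, w \in W /\ tensor_row coord w = row j A.
  by have [w ? ?] := rowA j; exists w.
have [w wP] := choice ex.
exists N, (fun j => tensor_row coord x 0 j), w; split=> [j|]; first by case: (wP j).
apply: (tensor_row_inj basis); rewrite -{1}xA (tensor_row_sum basis) mulmx_sum_row.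
apply: eq_bigr => j _; rewrite (tensor_rowZ basis) tensor_row_structure.
by have [_ ->] := wP j; rewrite map_row.
Qed.

Lemma row_extend_point (Q : algebra k) j : exists x : tensor V (restrict phi Q),
  tensor_row coord x = row j (extend_mx phi A Q).
Proof.
have [w _ wA] := rowA j; exists (tensor_map (structure_hom phi Q) w).
by rewrite tensor_row_structure wA map_row.
Qed.

Lemma extend_mx_map (Q Q' : algebra k) (f : algebra_hom Q Q') :
  map_mx (restrict_hom phi f) (extend_mx phi A Q) = extend_mx phi A Q'.
Proof. by apply/matrixP => a b; rewrite !mxE; apply: (hom_structure f (A a b)). Qed.

Local Notation Gk := (base_change_group phi G).

Lemma tensor_row_base_act (Q Q' : algebra k) (f : algebra_hom Q Q') (g : Gk Q)
    (h : tensor V (restrict phi Q')) :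
  tensor_row coord (act (base_change_action phi M) (gmap f g) h) =
  tensor_row coord h *m map_mx (restrict_hom phi f) (rho (Q := restrict phi Q) g).
Proof.
rewrite -(action_mx_map basis M (restrict_hom phi f)).
exact: (tensor_row_act basis M).
Qed.

(** The rows of A are points of W over Q itself, so the identity of Q already yields the equation;
    over every Q-algebra the points of W are combinations of these rows. *)
Lemma centraliser_fixing (Q : algebra k) (g : Gk Q) :
  centraliser (base_change_action phi M) (subspace_points W) g <-> fixing A g.
Proof.
split=> [cg|fg Q' f h /subspace_pointsP hA].
  apply/row_matrixP => j; rewrite row_mul.
  have [x xA] := row_extend_point Q j.
  have Yx : @subspace_points _ _ phi V W Q x.
    by apply/subspace_pointsP; rewrite xA -row_mul (extend_mx_idem gA).
  have := cg Q (hom_id Q) x Yx; rewrite gmap_id => gx.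
  by rewrite -xA -(tensor_row_act basis M); congr tensor_row.
apply: (tensor_row_inj basis).
rewrite tensor_row_base_act -{1}hA -(extend_mx_map f) -mulmxA -map_mxM fg.
by rewrite extend_mx_map.
Qed.

Lemma stabilising_points (Q : algebra k) (g : Gk Q) :
  stabilising A g <->
  forall Q' (f : algebra_hom Q Q') (h : tensor V (restrict phi Q')),
    @subspace_points _ _ phi V W Q' h ->
    @subspace_points _ _ phi V W Q' (act (base_change_action phi M) (gmap f g) h).
Proof.
split=> [sg Q' f h /subspace_pointsP hA|sg].
  apply/subspace_pointsP.
  rewrite tensor_row_base_act.
  rewrite -hA -(extend_mx_map f) -!mulmxA; congr (_ *m _).
  by rewrite mulmxA -!map_mxM sg.
apply/row_matrixP => j; rewrite !row_mul.
have [x xA] := row_extend_point Q j.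
have Yx : @subspace_points _ _ phi V W Q x.
  by apply/subspace_pointsP; rewrite xA -row_mul (extend_mx_idem gA).
have := sg Q (hom_id Q) x Yx; rewrite gmap_id => /subspace_pointsP.
by rewrite (tensor_row_act basis M) xA.
Qed.

Lemma normaliser_normalising (Q : algebra k) (g : Gk Q) :
  normaliser (base_change_action phi M) (subspace_points W) g <-> normalising A g.
Proof.
split=> [ng|[/stabilising_points sg /stabilising_points sg'] Q' f h Yh].
  by split; apply/stabilising_points => Q' f h /(ng Q' f)[].
by split; [apply: sg|apply: sg'].
Qed.

End Subspaces.

Section Equations.
Variables (n : nat) (B B' : 'M[{mpoly R[n]}]_N).
Variable co : forall Q : algebra R, G Q -> 'I_n -> Q.
Hypothesis BP : forall Q g, rho (Q := Q) g = map_mx (meval_at (structure_map Q) (co g)) B.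
Hypothesis B'P : forall Q g,
  rho (Q := Q) g^-1%g = map_mx (meval_at (structure_map Q) (co g)) B'.

Section Definitions.
Variables (k : comNzRingType) (phi : {rmorphism R -> k}) (A : 'M[k]_N).

Definition constant_mx : 'M[{mpoly k[n]}]_N := map_mx (mpolyC n (R := k)) A.

Definition fixing_system : 'M[{mpoly k[n]}]_N :=
  constant_mx *m map_mx (map_mpoly phi) B - constant_mx.

Definition stabilising_system (D : 'M[{mpoly R[n]}]_N) : 'M[{mpoly k[n]}]_N :=
  constant_mx *m map_mx (map_mpoly phi) D *m constant_mx -
  constant_mx *m map_mx (map_mpoly phi) D.

Definition normalising_system : 'M[{mpoly k[n]}]_(N, N + N) :=
  row_mx (stabilising_system B) (stabilising_system B').

End Definitions.

Section Naturality.
Variables (k k' : comNzRingType) (chi : {rmorphism k -> k'}).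
Variables (phi : {rmorphism R -> k}) (phi' : {rmorphism R -> k'}) (A : 'M[k]_N).
Hypothesis phiE : phi' =1 chi \o phi.

Let constant_natural :
  map_mx (map_mpoly chi) (constant_mx A) = constant_mx (map_mx chi A).
Proof. by apply/matrixP => a b; rewrite !mxE map_mpolyC. Qed.

Let poly_natural (D : 'M[{mpoly R[n]}]_N) :
  map_mx (map_mpoly chi) (map_mx (map_mpoly phi) D) = map_mx (map_mpoly phi') D.
Proof.
apply/matrixP => a b; rewrite !mxE; apply/mpolyP => mm.
by rewrite !mcoeff_map_mpoly; apply/esym/phiE.
Qed.

Lemma fixing_system_natural :
  map_mx (map_mpoly chi) (fixing_system phi A) = fixing_system phi' (map_mx chi A).
Proof. by rewrite map_mxB map_mxM poly_natural constant_natural. Qed.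

Let stabilising_natural (D : 'M[{mpoly R[n]}]_N) :
  map_mx (map_mpoly chi) (stabilising_system phi A D) =
  stabilising_system phi' (map_mx chi A) D.
Proof.
have e1 : map_mx (map_mpoly chi) (constant_mx A *m map_mx (map_mpoly phi) D) =
    constant_mx (map_mx chi A) *m map_mx (map_mpoly phi') D.
  by rewrite map_mxM constant_natural poly_natural.
by rewrite map_mxB map_mxM e1 constant_natural.
Qed.

Lemma normalising_system_natural :
  map_mx (map_mpoly chi) (normalising_system phi A) =
  normalising_system phi' (map_mx chi A).
Proof.
apply: (etrans (map_row_mx _ _ _)).
exact: (congr2 (@row_mx _ N N N) (stabilising_natural B) (stabilising_natural B')).
Qed.

End Naturality.

Section Solutions.
Variables (k : comNzRingType) (phi : {rmorphism R -> k}) (A : 'M[k]_N).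
Variables (Q : algebra k) (g : base_change_group phi G Q).
Local Notation ev := (meval_at (structure_map Q) (base_change_co co g)).

Let ev_constant : map_mx ev (constant_mx A) = extend_mx phi A Q.
Proof. by apply/matrixP => a b; rewrite !mxE meval_atC. Qed.

Let ev_poly (D : 'M[{mpoly R[n]}]_N) : map_mx ev (map_mx (map_mpoly phi) D) =
  map_mx (meval_at (structure_map (restrict phi Q)) (@co (restrict phi Q) g)) D.
Proof. by apply/matrixP => a b; rewrite !mxE; apply: base_change_eval. Qed.

Lemma fixing_zero : fixing A g <-> map_mx ev (fixing_system phi A) = 0.
Proof.
rewrite map_mxB map_mxM ev_constant ev_poly -(BP (Q := restrict phi Q)).
by split=> [fg|/subr0_eq]; last exact; apply/eqP; rewrite subr_eq0; apply/eqP.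
Qed.

Let stabilising_zero (D : 'M[{mpoly R[n]}]_N) (h : base_change_group phi G Q) :
  rho (Q := restrict phi Q) h =
    map_mx (meval_at (structure_map (restrict phi Q)) (@co (restrict phi Q) g)) D ->
  stabilising A h <-> map_mx ev (stabilising_system phi A D) = 0.
Proof.
move=> hD; have e1 : map_mx ev (constant_mx A *m map_mx (map_mpoly phi) D) =
    extend_mx phi A Q *m rho (Q := restrict phi Q) h.
  by rewrite map_mxM ev_constant ev_poly -hD.
rewrite map_mxB map_mxM e1 ev_constant.
by split=> [sh|/subr0_eq]; last exact; apply/eqP; rewrite subr_eq0; apply/eqP.
Qed.

Lemma normalising_zero : normalising A g <-> map_mx ev (normalising_system phi A) = 0.
Proof.
have [st1 st2] := stabilising_zero (BP (Q := restrict phi Q) g).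
have [st1' st2'] := stabilising_zero (B'P (Q := restrict phi Q) g).
rewrite map_row_mx; split=> [[/st1 sg /st1' sg']|].
  exact: (etrans (congr2 (@row_mx _ N N N) sg sg') (row_mx0 _ _ _ _)).
by rewrite -[RHS]row_mx0 => /eq_row_mx[/st2 sg /st2' sg'].
Qed.

End Solutions.
End Equations.
End Systems.

Lemma smooth_subgroup_ext (k : comNzRingType) (G : group_functor k)
    (S S' : forall Q, G Q -> Prop) :
  (forall Q g, S Q g <-> S' Q g) -> smooth_subgroup S' -> smooth_subgroup S.
Proof.
move=> SS' [A [smA [ev [ev1 ev2 ev3]]]]; exists A; split=> //; exists ev; split=> //.
by move=> Q x; rewrite SS'.
Qed.

Theorem corollary1p3 (R : comNzRingType) (G : group_functor R)
    (hG : algebraic_group G) (V : lmodType R)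
    (hfg : finitely_generated V) (hproj : projective V)
    (M : group_module G V) :
  exists pV : nat, prime pV /\
    forall (k : fieldType) (phi : {rmorphism R -> k}) (p : nat),
      (p \in [pchar k]%R) -> (pV <= p)%N ->
      forall W : {pred tensor V (Algebra phi)}, GRing.submod_closed W ->
        smooth_subgroup (centraliser (base_change_action phi M) (subspace_points W)) /\
        smooth_subgroup (normaliser (base_change_action phi M) (subspace_points W)).
Proof.
have [n [m [s [co chartG]]]] := algebraic_group_chart hG.
have [N [e [coord basis]]] := projective_dual_basis hfg hproj.
have [B BP] := natural_matrix_poly chartG (action_mx_map basis M).
have [|B' B'P] := natural_matrix_poly (theta := fun Q g => action_mx e coord M g^-1%g) chartG.
  by move=> Q Q' h g; rewrite -gmapV (action_mx_map basis).
have [N1 N1P] := uniform_smoothness chartG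
  (fun k k' chi phi phi' => @fixing_system_natural R N n B k k' chi phi phi')
  (fun k phi A Q g => fixing_zero BP A g)
  (fun k phi A gA Q => fixing_group basis M gA Q).
have [N2 N2P] := uniform_smoothness chartG
  (fun k k' chi phi phi' => @normalising_system_natural R N n B B' k k' chi phi phi')
  (fun k phi A Q g => normalising_zero BP B'P A g)
  (fun k phi A gA Q => normalising_group basis M gA Q).
(* If p is at least this prime, the integers from 1 to the larger bound are below p, hence nonzero
   in characteristic p. *)
have [pV lt_pV pV_prime] := prime_above (maxn N1 N2).
exists pV; split=> // k phi p pk le_p W W_closed.
have k_char d : (d < maxn N1 N2)%N -> d.+1%:R != 0 :> k.
  move=> lt_d; rewrite -(dvdn_pcharf pk) gtnNdvd //.
  by rewrite (leq_trans _ le_p) // (leq_ltn_trans lt_d).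
have [A [gA rowA fixA]] := subspace_projector basis W_closed.
split.
  apply: smooth_subgroup_ext (N1P k phi A _ gA) => [Q g|d lt_d].
    exact: (centraliser_fixing basis).
  by apply: k_char; rewrite leq_max lt_d.
apply: smooth_subgroup_ext (N2P k phi A _ gA) => [Q g|d lt_d].
  exact: (normaliser_normalising basis).
by apply: k_char; rewrite leq_max lt_d orbT.
Qed.
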